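(* Let $\ell\ge 1$ and suppose $n>1$. Let $\lambda:R^+\to\mathbb{C}^\times$ be any primitive linear character, let $X$ be the $\mathbb{C}\mathrm{U}$-module afforded by any Weil representation of $\mathrm{U}=\mathrm{U}(V,h)$ of type $\lambda$, and let $\mathrm{SU}=\{g\in \mathrm{U}\mid \det g=1\}$. Then, as an $\mathrm{SU}$-module, $X$ has exactly $2(q^{\ell-1}+q^{\ell-2}+\cdots+1)$ irreducible constituents, all non-isomorphic to each other. Thus, all irreducible $\mathrm{U}$-constituents of $X$ remain irreducible upon restriction to $\mathrm{SU}$ and non-isomorphic to each other.
   Context: Rings. Let $\mathcal{O}$ be a local principal ideal domain that is not a field, with maximal ideal $\mathcal{O}s$ and finite residue field $F_q$ of odd characteristic. Let $\mathcal{R}=\mathcal{O}[X]/(X^2-s)=\mathcal{O}\oplus\mathcal{O}t$, $t^2=s$, with the involution fixing $\mathcal{O}$ elementwise and sending $t\mapsto -t$. Fix $\ell\ge 1$ and set $A=\mathcal{R}/\mathcal{R}t^{2\ell-1}$, $R=\mathcal{O}/\mathcal{O}s^{\ell}$. Let $\pi$ be the image of $t$ in $A$ and $p$ the image of $s$ in $R$. Then $R$ embeds in $A$, $A=R\oplus R\pi$, $\pi^2=p$, and $A$ has an induced involution $*$ fixing $R$ elementwise and sending $\pi\mapsto-\pi$. Forms. $V$ is a free $A$-module of rank $2n$, and $h:V\times V\to A$ is a nondegenerate skew hermitian form: $h$ is $A$-linear in the second variable, $*$-linear in the first, $h(v,u)=-h(u,v)^*$, and $u\mapsto h(u,-)$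 is an injective map $V\to\mathrm{Hom}_A(V,A)$. $\mathrm{U}=\mathrm{U}(V,h)$ is the group of all $g\in\mathrm{GL}_A(V)$ preserving $h$. Put $f(v,w)=\frac{h(v,w)+h(v,w)^*}{2}\in R$; this is a nondegenerate alternating $R$-bilinear form on $V$. $\mathrm{Sp}=\mathrm{Sp}(V,f)$ is the group of all $g\in\mathrm{GL}_R(V)$ preserving $f$; thus $\mathrm{U}\le\mathrm{Sp}$. Weil representations. A linear character $\lambda:R^+\to\mathbb{C}^\times$ is primitive if its kernel contains no nonzero ideal of $R$. The Heisenberg group is $H=R\times V$ with $(r,u)(s,v)=(r+s+f(u,v),u+v)$ and center $(R,0)$, identified with $R^+$. Up to isomorphism $H$ has a unique irreducible complex representation $S:H\to\mathrm{GL}(X)$ on which $(R,0)$ acts via $\lambda$ (Schrödinger representation of type $\lambda$); its dimension is $\sqrt{|V|}$. For a subgroup $G\le\mathrm{Sp}$, a Weil representation of $G$ of type $\lambda$ is any representation $W:G\to\mathrm{GL}(X)$ with $W(g)S(r,u)W(g)^{-1}=S(r,gu)$ for all $g\in G$, $(r,u)\in H$. (Such representations exist, and any two differ by a linear character of $G$.) All representations are finite dimensional over $\mathbb{C}$. *)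

(* Defs.v *)
From HB Require Import structures.
#[warnings="-notation-overridden,-ambiguous-paths"]
From mathcomp Require Import all_boot ssrAC all_order all_algebra all_fingroup.
#[warnings="-notation-overridden,-ambiguous-paths"]
From mathcomp Require Import all_character.
From mathcomp Require Import qpoly.

Set Implicit Arguments.
Unset Strict Implicit.
Unset Printing Implicit Defensive.

Import GRing.Theory.
Local Open Scope ring_scope.

Definition is_ideal (B : comNzRingType) (I : B -> Prop) : Prop :=
  [/\ I 0, forall x y, I x -> I y -> I (x + y) & forall a x, I x -> I (a * x)].

Definition principal (B : comNzRingType) (a : B) : B -> Prop :=
  fun x => exists b, x = b * a.

Definition is_maximal_ideal (B : comNzRingType) (I : B -> Prop) : Prop :=
  [/\ is_ideal I, ~ I 1
    & forall J : B -> Prop, is_ideal J -> (forall x, I x -> J x) ->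
        ~ J 1 -> forall x, J x -> I x].

Record local_pid (O : idomainType) (s : O) : Prop := LocalPid {
  pid_principal : forall I : O -> Prop, is_ideal I ->
    exists a, forall x, I x <-> principal a x;
  pid_not_field : exists2 x : O, x != 0 & x \isn't a GRing.unit;
  pid_maximal : is_maximal_ideal (principal s);
  pid_local : forall I : O -> Prop, is_maximal_ideal I ->
    forall x, I x <-> principal s x
}.

(* [pr] presents [C] as the quotient ring [B / I]. *)
Definition is_quotient (B C : comNzRingType) (pr : {rmorphism B -> C})
    (I : B -> Prop) : Prop :=
  (forall c, exists b, pr b = c) /\ (forall b, pr b = 0 <-> I b).

Notation ramified s := {poly %/ 'X^2 - s%:P}.

Section Ramified.
Variables (O : idomainType) (s : O).

Definition ram_t : ramified s := 'qX.
Definition ram_const (a : O) : ramified s := qpolyC _ a.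
(* The representative of [x] has the form a + b 'X, so this is
   a + b t |-> a - b t. *)
Definition ram_conj (x : ramified s) : ramified s :=
  in_qpoly _ ((x : {poly O}) \Po (- 'X)).

Lemma mk_monic_ram : mk_monic ('X^2 - s%:P) = 'X^2 - s%:P :> {poly O}.
Proof. by rewrite /mk_monic size_XnsubC //= monicXnsubC. Qed.

Lemma ram_constE a : ram_const a = in_qpoly _ a%:P.
Proof.
apply: val_inj; rewrite /= Pdiv.CommonRing.rmodp_small //.
by rewrite (leq_ltn_trans (size_polyC_leq1 _)) // size_mk_monic_gt1.
Qed.

Lemma ram_constM : {morph ram_const : a b / a * b}.
Proof. exact: rmorphM. Qed.

Lemma ram_tt : ram_t * ram_t = ram_const s.
Proof.
rewrite ram_constE -rmorphM /= -expr2; apply/eqP; rewrite -subr_eq0 -rmorphB /=.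
apply/eqP/val_inj; rewrite /= mk_monic_ram.
by rewrite Pdiv.RingMonic.rmodpp ?monicXnsubC.
Qed.

Lemma ram_pairE a b :
  ram_const a + ram_const b * ram_t = a%:P + b%:P * 'X :> {poly O}.
Proof.
rewrite !ram_constE -rmorphM -rmorphD /= Pdiv.CommonRing.rmodp_small //.
rewrite mk_monic_ram size_XnsubC // (leq_ltn_trans (size_polyD _ _)) //.
rewrite gtn_max ltnS (leq_trans (size_polyC_leq1 _)) //= ltnS.
by rewrite mul_polyC (leq_trans (size_scale_leq _ _)) // size_polyX.
Qed.

Lemma ram_decomp (x : ramified s) :
  exists a b, x = ram_const a + ram_const b * ram_t.
Proof.
exists x`_0, x`_1; apply/val_inj; rewrite [RHS]ram_pairE.
have sx : (size (x : {poly O}) <= 2)%N.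
  by rewrite -ltnS (leq_trans (size_mk_monic x)) // mk_monic_ram size_XnsubC.
apply/polyP=> -[|[|i]];
  rewrite coefD coefCM coefX coefC /= ?mulr0 ?addr0 ?mulr1 ?add0r //.
by rewrite nth_default // (leq_trans sx).
Qed.

Lemma ram_conjE a b :
  ram_conj (ram_const a + ram_const b * ram_t) =
  ram_const a - ram_const b * ram_t.
Proof.
rewrite /ram_conj ram_pairE comp_polyD comp_polyM !comp_polyC comp_polyX.
by rewrite mulrN rmorphB rmorphM /= -!ram_constE.
Qed.

Lemma ram_const_principal ell a : (0 < ell)%N ->
  principal (ram_t ^+ (2 * ell - 1)) (ram_const a) -> principal (s ^+ ell) a.
Proof.
case: ell => // ell _ [y]; have [c [d ->]] := ram_decomp y.
have -> : (2 * ell.+1 - 1 = (2 * ell).+1)%N by rewrite mulnS addSn subn1.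
rewrite (exprS ram_t) (exprM ram_t) (expr2 ram_t) ram_tt mulrA.
have -> : ram_const s ^+ ell = ram_const (s ^+ ell) by rewrite /ram_const rmorphXn.
rewrite mulrDl -mulrA ram_tt.
have -> : (ram_const c * ram_t + ram_const d * ram_const s) * ram_const (s ^+ ell)
   = ram_const (d * s ^+ ell.+1) + ram_const (c * s ^+ ell) * ram_t.
  rewrite (exprS s) !ram_constM mulrDl [LHS]addrC; congr (_ + _).
    by rewrite (mulrA (ram_const d)).
  by rewrite mulrAC.
move=> /(congr1 (fun x : ramified s => (x : {poly O})`_0)).
rewrite ram_pairE /= coefD coefMX coefC !coefC /= addr0 => ->.
by exists d.
Qed.

End Ramified.

(* R = O / (s^ell) and A = ramified s / (t^(2 ell - 1)), each given by its
   projection; the embedding R -> A and the involution of A are the maps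
   induced by those of [ramified s], hence are determined by the projections. *)
Record quotient_rings (O : idomainType) (s : O) (ell : nat) := QuotientRings {
  baseR : finComNzRingType;
  extA : finComUnitRingType;
  projR : {rmorphism O -> baseR};
  projA : {rmorphism ramified s -> extA};
  projR_quotient : is_quotient projR (principal (s ^+ ell));
  projA_quotient : is_quotient projA (principal (ram_t s ^+ (2 * ell - 1)));
  embR : {rmorphism baseR -> extA};
  embR_proj : forall a, embR (projR a) = projA (ram_const s a);
  starA : {rmorphism extA -> extA};
  starA_proj : forall x, starA (projA x) = projA (ram_conj x)
}.

Section QuotientRingsTheory.
Variables (O : idomainType) (s : O) (ell : nat) (Q : quotient_rings s ell).

Lemma ell_gt0 : (0 < ell)%N.
Proof.
case: (posnP ell) => // ell0; have [_ /(_ 1)] := projA_quotient Q.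
rewrite rmorph1 => -[_ H]; have /eqP : (1 : extA Q) = 0.
  by apply: H; exists 1; rewrite ell0 expr0 mulr1.
by rewrite oner_eq0.
Qed.

Lemma embR_inj : injective (embR Q).
Proof.
apply: raddf_inj => r; have [surj ker] := projR_quotient Q.
have [a <-] := surj r; move=> /= Ha.
have {}Ha : projA Q (ram_const s a) = 0 by rewrite -embR_proj.
apply/ker/ram_const_principal; first exact: ell_gt0.
by have [_ kerA] := projA_quotient Q; apply/kerA.
Qed.

(* The trace part of [x]: (x + x^* ) / 2, seen in R. *)
Definition halftr (x : extA Q) : baseR Q :=
  odflt 0 [pick r | embR Q r == (x + starA Q x) / 2%:R].

Lemma embR_halftr x : embR Q (halftr x) = (x + starA Q x) / 2%:R.
Proof.
have [r2 Er2] : exists r2, embR Q r2 = 2%:R^-1.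
  have [U2|U2] := boolP (2%:R \is a @GRing.unit (extA Q)); last first.
    by exists 2%:R; rewrite invr_out // rmorph_nat.
  have inj2 : injective (fun r : baseR Q => r * 2%:R).
    move=> r r' /(congr1 (embR Q)); rewrite !rmorphM rmorph_nat.
    by move/(mulIr U2)/embR_inj.
  exists (invF inj2 1); apply: (mulIr U2).
  by rewrite mulVr // -[in LHS](rmorph_nat (embR Q)) -rmorphM (f_invF inj2) rmorph1.
have [r Er] : exists r, embR Q r = x + starA Q x.
  have [/(_ x)[y <-] _] := projA_quotient Q; have [a [b ->]] := ram_decomp y.
  exists (projR Q (a + a)); rewrite starA_proj ram_conjE embR_proj -rmorphD.
  by rewrite addrACA subrr addr0 /ram_const rmorphD.
rewrite /halftr; case: pickP => [r' /eqP // | /(_ (r * r2))].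
by rewrite rmorphM Er Er2 eqxx.
Qed.

Lemma halftrD : {morph halftr : x y / x + y}.
Proof.
by move=> x y; apply: embR_inj; rewrite rmorphD !embR_halftr rmorphD /= addrACA mulrDl.
Qed.

End QuotientRingsTheory.

(* {'GL_m[A]} consists of matrices of size m.-1.+1; for m > 0 this is A^m. *)
Notation colspace Q m := 'cV[extA Q]_m.-1.+1.

Record skew_hermitian (O : idomainType) (s : O) (ell : nat)
    (Q : quotient_rings s ell) (m : nat) := SkewHermitian {
  herm :> colspace Q m -> colspace Q m -> extA Q;
  hermDr : forall u v w, herm u (v + w) = herm u v + herm u w;
  hermZr : forall u a v, herm u (a *: v) = a * herm u v;
  hermDl : forall u v w, herm (u + v) w = herm u w + herm v w;
  hermZl : forall a u v, herm (a *: u) v = starA Q a * herm u v;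
  herm_skew : forall u v, herm v u = - starA Q (herm u v)
}.

Section Unitary.
Variables (O : idomainType) (s : O) (ell : nat) (Q : quotient_rings s ell).
Variables (m : nat) (h : skew_hermitian Q m).

Definition nondegenerate_herm : Prop :=
  forall u u', (forall v, h u v = h u' v) -> u = u'.

Definition unitary_set : {set {'GL_m[extA Q]}} :=
  [set g : {'GL_m[extA Q]} |
    [forall u, forall v, h (GLval g *m u) (GLval g *m v) == h u v]].

Lemma unitary_setP (g : {'GL_m[extA Q]}) :
  reflect (forall u v, h (GLval g *m u) (GLval g *m v) = h u v)
          (g \in unitary_set).
Proof.
rewrite inE; apply: (iffP forallP) => [H u v | H u].
  by apply/eqP; move/forallP: (H u).
by apply/forallP=> v; apply/eqP.
Qed.

Lemma unitary_group_set : group_set unitary_set.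
Proof.
apply/group_setP; split=> [|x y /unitary_setP hx /unitary_setP hy].
  by apply/unitary_setP=> u v; rewrite GL_1E !mul1mx.
by apply/unitary_setP=> u v; rewrite GL_ME -!mulmxA hx hy.
Qed.
Canonical unitary := Group unitary_group_set.

Definition special_unitary_set : {set {'GL_m[extA Q]}} :=
  unitary :&: [set g | \det (GLval g) == 1].

Lemma special_unitary_group_set : group_set special_unitary_set.
Proof.
apply/group_setP; split=> [|x y].
  by rewrite in_setI group1 inE GL_1E det1 eqxx.
rewrite !in_setI => /andP[Ux]; rewrite inE => /eqP dx.
move=> /andP[Uy]; rewrite inE => /eqP dy.
by rewrite groupM //= inE GL_ME det_mulmx dx dy mulr1.
Qed.
Canonical special_unitary := Group special_unitary_group_set.

Lemma special_unitary_sub : special_unitary \subset unitary.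
Proof. exact: subsetIl. Qed.

Definition alt_form (u v : colspace Q m) : baseR Q := halftr (h u v).

Lemma alt_formDl u v w : alt_form (u + v) w = alt_form u w + alt_form v w.
Proof. by rewrite /alt_form hermDl halftrD. Qed.

Lemma alt_formDr u v w : alt_form u (v + w) = alt_form u v + alt_form u w.
Proof. by rewrite /alt_form hermDr halftrD. Qed.

Lemma alt_form0l w : alt_form 0 w = 0.
Proof. by apply: (addrI (alt_form 0 w)); rewrite -alt_formDl !addr0. Qed.

Lemma alt_formNl u w : alt_form (- u) w = - alt_form u w.
Proof. by apply/eqP; rewrite -addr_eq0 -alt_formDl addNr alt_form0l. Qed.

End Unitary.

(* The Heisenberg group of [h] has underlying set R x V; the parameter [h]
   determines its multiplication, see [heis_mul]. *)
Record heisenberg (O : idomainType) (s : O) (ell : nat)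
    (Q : quotient_rings s ell) (m : nat) (h : skew_hermitian Q m) :
    predArgType := Heis {
  heis_fst : baseR Q;
  heis_snd : colspace Q m
}.

Section HeisenbergGroup.
Variables (O : idomainType) (s : O) (ell : nat) (Q : quotient_rings s ell).
Variables (m : nat) (h : skew_hermitian Q m).

Local Notation alt_form := (alt_form h).
Local Notation heisenberg := (heisenberg h).

Definition heis_to_pair (x : heisenberg) := (heis_fst x, heis_snd x).
Definition heis_of_pair p : heisenberg := Heis h p.1 p.2.
Fact heis_to_pairK : cancel heis_to_pair heis_of_pair.
Proof. by case. Qed.

HB.instance Definition _ :=
  Finite.copy heisenberg (can_type heis_to_pairK).

Definition heis_mul (x y : heisenberg) : heisenberg :=
  let: Heis r u := x in let: Heis r' v := y in
  Heis h (r + r' + alt_form u v) (u + v).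
Definition heis_one : heisenberg := Heis h 0 0.
Definition heis_inv (x : heisenberg) : heisenberg :=
  let: Heis r u := x in Heis h (- r + alt_form u u) (- u).

Fact heis_mulA : associative heis_mul.
Proof.
move=> [r u] [r' v] [r'' w]; rewrite /= alt_formDl alt_formDr !addrA.
by congr Heis; rewrite [LHS](ACl (1*2*5*3*6*4)).
Qed.

Fact heis_mul1 : left_id heis_one heis_mul.
Proof. by move=> [r u]; rewrite /= alt_form0l !add0r addr0. Qed.

Fact heis_mulV : left_inverse heis_one heis_inv heis_mul.
Proof. by move=> [r u]; rewrite /= alt_formNl addNr addrAC addrK addNr. Qed.

HB.instance Definition _ :=
  Finite_isGroup.Build heisenberg heis_mulA heis_mul1 heis_mulV.

Section Weil.
Variables (C : fieldType) (lam : baseR Q -> C) (d : nat).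

Definition primitive_character : Prop :=
  [/\ forall r, lam r != 0, forall r r', lam (r + r') = lam r * lam r'
    & forall I : baseR Q -> Prop, is_ideal I -> (forall r, I r -> lam r = 1) ->
        forall r, I r -> r = 0].

Definition is_schrodinger
    (S : mx_representation C [set: heisenberg] d) : Prop :=
  mx_irreducible S /\ (forall r, S (Heis h r 0) = (lam r)%:M).

Definition is_weil (S : mx_representation C [set: heisenberg] d)
    (W : mx_representation C (unitary h) d) : Prop :=
  forall g r u, g \in unitary h ->
    W g *m S (Heis h r u) *m invmx (W g) = S (Heis h r (GLval g *m u)).

End Weil.
End HeisenbergGroup.

(* Main.v *)
Require Import Defs.
From HB Require Import structures.
From mathcomp Require Import all_boot all_order all_algebra all_fingroup.
From mathcomp Require Import all_character.
From mathcomp Require Import qpoly complex reals ring.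

(* The operators S(0, v), v in V, form a basis of End(X), and conjugation by W(g)
   sends S(0, v) to S(0, g v).  Hence the commutant of SU consists of the sums
   of the S(0, v) whose coefficients are constant on SU-orbits, and its dimension
   is the number of SU-orbits on V.
   Every v in V is pi^i w with w primitive (h(w, V) = A), and by a Witt type
   theorem, where n > 1 provides isometries of any needed determinant
   fixing w, the orbit of v is determined by i and pi^i h(w, w).  So U and SU have
   the same orbits, and counting the possible values of the invariant gives
   2 (q^(l-1) + ... + 1) of them.
   The Gram matrix of h is congruent to its transpose, which yields an additive
   sigma : V -> V with h(sigma u, sigma v) = h(v, u).  It preserves the orbit
   invariant, so the anti-automorphism S(0, v) |-> S(0, sigma v) of End(X) fixes the
   commutant pointwise; the commutant is therefore commutative, X is
   multiplicity free, and the number of its constituents is the dimension of the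
   commutant.  As U and SU have the same commutant, the constituents are the same. *)

Set Implicit Arguments.
Unset Strict Implicit.
Unset Printing Implicit Defensive.

Import GRing.Theory.
Local Open Scope ring_scope.

(** * Finite ramified chain rings *)

(* The ring A = R + R pi with residue field F; pi has nilpotency index
   2 k + 1 = 2 l - 1. *)
Record ramified_chain_ring (A : finComUnitRingType) (star : {rmorphism A -> A})
    (pi : A) (F : finFieldType) (rho : {rmorphism A -> F}) (k : nat) : Prop :=
  RamifiedChainRing {
  chain_starK : involutive star;
  chain_star_pi : star pi = - pi;
  chain_split : forall a, exists x y,
    [/\ star x = x, star y = y & a = x + y * pi];
  chain_pi_nil : pi ^+ k.*2.+1 = 0;
  chain_pi_top : pi ^+ k.*2 != 0;
  chain_rho_surj : forall t, exists a, rho a = t;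
  chain_rho_ker : forall a, rho a = 0 <-> exists b, a = pi * b;
  chain_two : 2%:R != 0 :> F
}.

Section ChainRing.
Variables (A : finComUnitRingType) (star : {rmorphism A -> A}) (pi : A).
Variables (F : finFieldType) (rho : {rmorphism A -> F}) (k : nat).
Hypothesis AP : ramified_chain_ring star pi rho k.

Let starK := chain_starK AP.
Let star_pi := chain_star_pi AP.

Lemma rho_pi : rho pi = 0.
Proof. by apply/(chain_rho_ker AP); exists 1; rewrite mulr1. Qed.

(** If [rho x] is nonzero, lift its inverse to [y]: then [1 - x * y] is a multiple of [pi], hence
    nilpotent, and a geometric series inverts [x * y]. *)
Lemma unit_chainE x : (x \is a GRing.unit) = (rho x != 0).
Proof.
apply/idP/idP => [/(rmorph_unit rho)|nz]; first by rewrite unitfE.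
have [y ry] := chain_rho_surj AP (rho x)^-1.
have [z Ez] : exists z, 1 - x * y = pi * z.
  by apply/(chain_rho_ker AP); rewrite rmorphB rmorph1 rmorphM ry divff ?subrr.
have : 1 - (pi * z) ^+ k.*2.+1 = 1 by rewrite exprMn (chain_pi_nil AP) mul0r subr0.
rewrite -{1}(expr1n A k.*2.+1) subrXX -Ez subKr -mulrA.
set w := (X in y * X) => yw.
by apply/unitrPr; exists (y * w).
Qed.

Lemma rho0P x : rho x = 0 -> exists y, x = pi * y.
Proof. by move/(chain_rho_ker AP). Qed.

Lemma two_unit : (2%:R : A) \is a GRing.unit.
Proof. by rewrite unit_chainE rmorph_nat (chain_two AP). Qed.

Lemma mul2_eq0 (x : A) : x + x = 0 -> x = 0.
Proof.
by rewrite -mulr2n -mulr_natr => /(canRL (mulrK two_unit)); rewrite mul0r.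
Qed.

Lemma rho_star x : rho (star x) = rho x.
Proof.
have [e [e' [Ee Ee' ->]]] := chain_split AP x.
rewrite !rmorphD !rmorphM /= star_pi Ee Ee' rmorphN.
by rewrite rho_pi oppr0.
Qed.

Lemma pi_exp_eq0 i : (pi ^+ i == 0) = (k.*2 < i)%N.
Proof.
case: ltnP => [lt|le]; first by rewrite -(subnK lt) exprD (chain_pi_nil AP) mulr0 eqxx.
apply: contraNF (chain_pi_top AP) => /eqP pi0.
by rewrite -(subnK le) exprD pi0 mulr0.
Qed.

Lemma star_piX i : star (pi ^+ i) = (-1) ^+ i * pi ^+ i.
Proof. by rewrite rmorphXn /= star_pi [LHS]exprNn. Qed.

Definition skew (a : A) : bool := star a == - a.

Lemma skewP a : reflect (star a = - a) (skew a).
Proof. exact: eqP. Qed.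

Lemma skew_pi a : skew a -> exists2 e, star e = e & a = e * pi.
Proof.
have [e [e' [Ee Ee' ->]]] := chain_split AP a; move/skewP.
rewrite rmorphD rmorphM /= star_pi Ee Ee' mulrN opprD => /addIr.
move/eqP; rewrite -addr_eq0 => /eqP/mul2_eq0->.
by exists e'; rewrite // add0r.
Qed.

Lemma fix_pi_skew e : star e = e -> skew (e * pi).
Proof. by move=> Ee; apply/skewP; rewrite rmorphM /= star_pi Ee mulrN. Qed.

Lemma rho_skew a : skew a -> rho a = 0.
Proof. by case/skew_pi=> e _ ->; rewrite rmorphM rho_pi mulr0. Qed.

Lemma fix_rho0 a : star a = a -> rho a = 0 ->
  exists2 e, star e = e & a = pi ^+ 2 * e.
Proof.
move=> Ea /rho0P[b Eb]; have [e [e' [Ee Ee' Eb']]] := chain_split AP b.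
move: Ea; rewrite {a}Eb {b}Eb' rmorphM rmorphD rmorphM /= star_pi Ee Ee'.
move=> E; exists e' => //; rewrite expr2.
have : pi * e + pi * e = 0.
  rewrite -[RHS](subrr (pi * (e + e' * pi))) -{2}E; ring.
by move/mul2_eq0; rewrite mulrDr => ->; ring.
Qed.

(* The map [a |-> 2 a - a ^ 2 b] is injective on a finite set that it
   preserves, hence surjective. *)
Lemma skew_quadratic i b d : skew b -> skew d -> pi ^+ i * d = 0 ->
  exists a, [/\ skew a, pi ^+ i * a = 0 & a * 2%:R - a ^+ 2 * b = d].
Proof.
move=> skb sd pd; have /skewP sb := skb; pose X := [set a | skew a & pi ^+ i * a == 0].
pose f a := a * 2%:R - a ^+ 2 * b.
have fX : f @: X \subset X.
  apply/subsetP=> _ /imsetP[a + ->]; rewrite !inE => /andP[/eqP sa /eqP pa].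
  rewrite /f /skew rmorphB !rmorphM !rmorph_nat /= sa sb.
  apply/andP; split; first by apply/eqP; ring.
  by rewrite mulrBr expr2 !mulrA pa !mul0r subr0 eqxx.
have f_inj : {in X &, injective f}.
  move=> x y; rewrite !inE => /andP[sx _] /andP[sy _] /eqP.
  rewrite -subr_eq0 /f.
  have -> : x * 2%:R - x ^+ 2 * b - (y * 2%:R - y ^+ 2 * b) =
            (x - y) * (2%:R - (x + y) * b) by ring.
  have u : 2%:R - (x + y) * b \is a GRing.unit.
    rewrite unit_chainE rmorphB rmorphM (rho_skew skb).
    by rewrite mulr0 subr0 rmorph_nat (chain_two AP).
  move/eqP/(canRL (mulrK u)); rewrite mul0r => /eqP.
  by rewrite subr_eq0 => /eqP.
have /eqP fXX : f @: X == X by rewrite eqEcard fX (card_in_imset f_inj) leqnn.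
have : d \in X by rewrite inE sd pd eqxx.
rewrite -fXX => /imsetP[a]; rewrite inE => /andP[sa /eqP pa] ->.
by exists a.
Qed.

Definition fixed_set : {set A} := [set x | star x == x].
(** Skew elements are the fixed multiples of [pi], so [layer i.+1] is where [pi ^+ i * h w w] takes
    its values. *)
Definition layer (j : nat) : {set A} := [set pi ^+ j * x | x in fixed_set].

Lemma card_layer_ge j : (k.*2 < j)%N -> #|layer j| = 1%N.
Proof.
rewrite -pi_exp_eq0 => /eqP pj; rewrite /layer pj.
suff -> : [set 0 * x | x in fixed_set] = [set 0] by rewrite cards1.
apply/setP=> x; rewrite inE; apply/imsetP/eqP => [[y _ ->]|->].
  by rewrite mul0r.
by exists 0; rewrite ?mulr0 // inE rmorph0.
Qed.

(** By [fix_rho0] a fixed element is a fixed lift [c t] of its residue plus [pi ^+ 2] times a fixed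
    element. Splitting off this leading digit, unique because [pi ^+ j != 0], matches [layer j] with
    pairs in [F] and [layer j.+2]. *)
Lemma card_layer j : (j <= k.*2)%N -> #|layer j| = (#|F| * #|layer j.+2|)%N.
Proof.
move=> lej; have nzj : pi ^+ j != 0 by rewrite pi_exp_eq0 -leqNgt.
have /fin_all_exists2[c rc fc] t : exists2 x, rho x = t & star x = x.
  have [a <-] := chain_rho_surj AP t.
  have [x [y [Ex _ ->]]] := chain_split AP a.
  by exists x; rewrite // rmorphD rmorphM rho_pi mulr0 addr0.
pose f (ty : F * A) := pi ^+ j * c ty.1 + ty.2.
have -> : layer j = f @: setX setT (layer j.+2).
  apply/setP=> x; apply/imsetP/imsetP=> [[y]|[[t y]]].
    rewrite inE => /eqP Ey ->.
    have [||e Ee Ey'] := @fix_rho0 (y - c (rho y)).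
    - by rewrite rmorphB /= Ey fc.
    - by rewrite rmorphB rc subrr.
    exists (rho y, pi ^+ j.+2 * e).
      by rewrite !inE /=; apply/imsetP; exists e; rewrite // inE Ee.
    by rewrite /f /= -[j.+2]addn2 exprD -mulrA -Ey'; ring.
  rewrite !inE /= => /imsetP[e]; rewrite inE => /eqP Ee -> ->.
  exists (c t + pi ^+ 2 * e).
    by rewrite inE rmorphD rmorphM rmorphXn /= star_pi sqrrN fc Ee.
  by rewrite /f /= -[j.+2]addn2 exprD; ring.
rewrite card_in_imset ?cardsX ?cardsT // => -[t x] [t' x'].
rewrite !inE /= => /imsetP[e _ ->] /imsetP[e' _ ->]; rewrite /f /= => E.
have Et : t = t'.
  apply: contraNeq nzj => nt.
  have u : c t - c t' + pi * (pi * (e - e')) \is a GRing.unit.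
    by rewrite unit_chainE rmorphD rmorphM rho_pi mul0r addr0 rmorphB !rc subr_eq0.
  rewrite -(mulIr_eq0 _ (mulIr u)); apply/eqP.
  move/eqP: E; rewrite -subr_eq0 => /eqP <-.
  by rewrite -[j.+2]addn2 exprD; ring.
by move: E; rewrite Et => /addrI ->.
Qed.

(** Descending from the two trivial layers [k.*2.+1] and [k.*2.+2], each step by two multiplies the
    size by [#|F|]. Consecutive odd and even layers thus have equal size, whence the factor 2. *)
Lemma sum_card_layer :
  (\sum_(i < k.*2.+2) #|layer i.+1| = 2 * \sum_(i < k.+1) #|F| ^ i)%N.
Proof.
have layerE i : (i <= k)%N ->
    #|layer (k - i).*2.+1| = (#|F| ^ i)%N /\ #|layer (k - i).*2.+2| = (#|F| ^ i)%N.
  elim: i => [_|i IH lti]; first by rewrite subn0 !card_layer_ge.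
  have [IH1 IH2] := IH (ltnW lti).
  have Ek : (k - i = (k - i.+1).+1)%N by rewrite subnS prednK // subn_gt0.
  have le1 : ((k - i.+1).*2.+2 <= k.*2)%N by rewrite -doubleS -Ek leq_double leq_subr.
  rewrite expnS -{1}IH1 -IH2 Ek doubleS.
  by split; apply: card_layer => //; apply: ltnW.
have pairs (f : nat -> nat) n :
    (\sum_(i < n.*2) f i = \sum_(i < n) (f i.*2 + f i.*2.+1))%N.
  elim: n => [|n IH]; first by rewrite !big_ord0.
  by rewrite doubleS !big_ord_recr /= IH addnA.
rewrite -doubleS (pairs (fun i => #|layer i.+1|)) (reindex_inj rev_ord_inj).
rewrite big_distrr; apply: eq_bigr => i _ /=.
by rewrite subSS; have [-> ->] := layerE i (ltn_ord i); rewrite mul2n addnn.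
Qed.

End ChainRing.

(** * Congruence of a skew hermitian matrix and its transpose *)

Definition adjmx (A : comUnitRingType) (star : A -> A) m n (M : 'M[A]_(m, n)) :
  'M[A]_(n, m) := (map_mx star M)^T.

Lemma det2 (R : comNzRingType) (P : 'M[R]_2) :
  \det P = P 0 0 * P 1 1 - P 0 1 * P 1 0.
Proof.
have E1 : lift ord0 ord0 = 1 :> 'I_2 by apply: val_inj.
have E0 : lift 1 ord0 = 0 :> 'I_2 by apply: val_inj.
rewrite (expand_det_row _ 0) !big_ord_recl big_ord0 /cofactor !det_mx11 !mxE E1.
by rewrite E0 /= expr0 expr1 mul1r addr0 mulN1r mulrN.
Qed.

(** An injective self-map of the finite set of columns is bijective; preimages of the unit vectors
    form a right inverse. *)
Lemma finmx_unit (A : finComUnitRingType) m (M : 'M[A]_m) :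
  (forall v : 'cV_m, M *m v = 0 -> v = 0) -> M \in unitmx.
Proof.
move=> kerM; have inj : injective (fun v : 'cV_m => M *m v).
  move=> u v /eqP; rewrite -subr_eq0 -mulmxBr => /eqP/kerM/eqP.
  by rewrite subr_eq0 => /eqP.
have [g _ gK] := injF_bij inj.
have : M *m (\matrix_(i, j) g (col j 1%:M) i 0) = 1%:M.
  apply/matrixP=> i j; have /matrixP/(_ i 0) := gK (col j 1%:M).
  by rewrite [in RHS]mxE => <-; rewrite !mxE; apply: eq_bigr => l _; rewrite mxE.
by case/mulmx1_unit.
Qed.

Section TransposeCongruence.
Variables (A : finComUnitRingType) (star : {rmorphism A -> A}) (pi : A).
Variables (F : finFieldType) (rho : {rmorphism A -> F}) (k : nat).
Hypothesis AP : ramified_chain_ring star pi rho k.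
Local Notation adj := (adjmx star).

Lemma adjmxK m n (M : 'M[A]_(m, n)) : adj (adj M) = M.
Proof. by apply/matrixP=> i j; rewrite !mxE (chain_starK AP). Qed.

Lemma adjmxM m n p (M : 'M[A]_(m, n)) (N : 'M_(n, p)) :
  adj (M *m N) = adj N *m adj M.
Proof. by rewrite /adjmx map_mxM trmx_mul. Qed.

Lemma adjmxD m n (M N : 'M[A]_(m, n)) : adj (M + N) = adj M + adj N.
Proof. by rewrite /adjmx map_mxD linearD. Qed.

Lemma adjmxN m n (M : 'M[A]_(m, n)) : adj (- M) = - adj M.
Proof. by rewrite /adjmx map_mxN linearN. Qed.

Lemma adjmx0 m n : adj (0 : 'M_(m, n)) = 0.
Proof. by rewrite /adjmx map_mx0 trmx0. Qed.

Lemma adjmx1 m : adj (1%:M : 'M_m) = 1%:M.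
Proof. by rewrite /adjmx map_mx1 trmx1. Qed.

Lemma adj_block_mx m1 m2 n1 n2 (P : 'M_(m1, n1)) (Q : 'M_(m1, n2))
    (R : 'M_(m2, n1)) (T : 'M_(m2, n2)) :
  adj (block_mx P Q R T) = block_mx (adj P) (adj R) (adj Q) (adj T).
Proof. by rewrite /adjmx map_block_mx tr_block_mx. Qed.

Lemma adjmx_unit m (B : 'M[A]_m) : (adj B \in unitmx) = (B \in unitmx).
Proof.
rewrite /adjmx !unitmxE det_tr det_map_mx.
apply/idP/idP => [/(rmorph_unit star)|]; last exact: rmorph_unit.
by rewrite (chain_starK AP).
Qed.

(** Such a [D], composed with entrywise [star], gives a semilinear map that swaps the arguments of
    the form with Gram matrix [H]. *)
Definition transposable m (H : 'M[A]_m) : Prop := exists D, adj D *m H *m D = H^T.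

Lemma transposable_congr m (H B : 'M[A]_m) : B \in unitmx ->
  transposable (adj B *m H *m B) -> transposable H.
Proof.
move=> uB [D ED]; pose Bc := map_mx star B.
have uBc : Bc \in unitmx by rewrite -unitmx_tr adjmx_unit.
(* The transpose of [adj B *m H *m B] is [adj Bc *m H^T *m Bc], so on the transposed side the change
   of basis is undone by [Bc]. *)
exists (B *m D *m invmx Bc); rewrite !adjmxM -!mulmxA.
have -> : adj D *m (adj B *m (H *m (B *m (D *m invmx Bc)))) =
   adj D *m (adj B *m H *m B) *m D *m invmx Bc by rewrite !mulmxA.
rewrite ED !trmx_mul trmxK -/Bc -!mulmxA mulmxV // mulmx1 mulmxA.
suff -> : adj (invmx Bc) *m B^T = 1%:M by rewrite mul1mx.
have -> : B^T = adj Bc.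
  by apply/matrixP=> i j; rewrite !mxE (chain_starK AP).
by rewrite -adjmxM mulmxV // adjmx1.
Qed.

(** The diagonal matrix with entries 1 and [d = P 1 0 / P 0 1] works: skewness gives
    [star d * d = 1], so the diagonal of [P] is kept and the two other entries are exchanged. *)
Lemma transposable2 (P : 'M[A]_2) : adj P = - P -> P 0 1 \is a GRing.unit ->
  transposable P.
Proof.
move=> skP uc.
have sP i j : star (P i j) = - P j i.
  by have /matrixP/(_ j i) := skP; rewrite !mxE.
have uc' : star (P 0 1) \is a GRing.unit by rewrite rmorph_unit.
pose d := P 1 0 / P 0 1.
have sd : star d = (P 0 1) / (P 1 0).
  by rewrite /d rmorphM rmorphV //= !sP invrN mulrNN.
have uc2 : P 1 0 \is a GRing.unit by rewrite -[P 1 0]opprK -sP unitrN.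
exists (\matrix_(i, j) if i == j then if i == 0 then 1 else d else 0).
have I2 (i : 'I_2) : i = 0 \/ i = 1.
  by case: i => -[|[|//]] ?; [left | right]; apply: val_inj.
have E1 : lift ord0 ord0 = 1 :> 'I_2 by apply: val_inj.
have dP : P 0 1 * d = P 1 0 by rewrite mulrC divrK.
have sdP : star d * P 1 0 = P 0 1 by rewrite sd divrK.
have sdd : star d * d = 1 by rewrite sd /d mulrA divrK // divrr.
apply/matrixP=> i j; rewrite !mxE !big_ord_recl !big_ord0 !mxE.
rewrite !big_ord_recl !big_ord0 !mxE E1 /=.
have [->|->] := I2 i; have [->|->] := I2 j; rewrite /= ?rmorph0 ?rmorph1.
- by rewrite !(mul0r, mulr0, mul1r, mulr1, addr0).
- by rewrite !(mul0r, mulr0, mul1r, addr0, add0r) dP.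
- by rewrite !(mul0r, mulr0, mulr1, addr0, add0r) sdP.
- by rewrite !(mul0r, mulr0, addr0, add0r) mulrAC sdd mul1r.
Qed.

(** Diagonal entries are skew, hence non-units, so the first row of an invertible [H] has a unit off
    the diagonal. Moved to position (0, 1), it makes the leading 2 by 2 block invertible; that block
    splits off and induction handles the rest. *)
Lemma skew_mx_transposable m (H : 'M[A]_m) : adj H = - H -> H \in unitmx ->
  transposable H.
Proof.
have [N] := ubnP m; elim: N m H => // N IH [|[|m]] H ltm skH uH.
- by exists 1%:M; apply/matrixP=> -[].
- exists 1%:M; rewrite adjmx1 mulmx1 mul1mx; apply/matrixP=> i j.
  by rewrite !mxE !ord1.
have [j uj] : exists j, H 0 j \is a GRing.unit.
  apply/existsP; apply: contraLR uH; rewrite negb_exists => /forallP nu.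
  rewrite unitmxE (unit_chainE AP) negbK -det_map_mx.
  rewrite (expand_det_row _ 0) big1 // => j _; rewrite mxE.
  by have := nu j; rewrite (unit_chainE AP) negbK => /eqP->; rewrite mul0r.
have nj0 : j != 0.
  apply: contraTneq uj => ->; rewrite (unit_chainE AP) negbK; apply/eqP.
  apply: (rho_skew AP); apply/skewP.
  by have /matrixP/(_ 0 0) := skH; rewrite !mxE.
pose s : 'M[A]_m.+2 := tperm_mx 1 j.
have us : s \in unitmx by apply: unitmx_perm.
apply: (transposable_congr us).
set H1 := adj s *m H *m s.
have skH1 : adj H1 = - H1.
  by rewrite !adjmxM skH adjmxK mulNmx mulmxN /H1 mulmxA.
have uH1 : H1 \in unitmx by rewrite !unitmx_mul adjmx_unit us uH.
have uH01 : @ulsubmx _ 2 m 2 m H1 0 1 \is a GRing.unit.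
  have -> : H1 = xrow 1 j (xcol 1 j H).
    rewrite xrowE xcolE mulmxA /H1; congr (_ *m _ *m _).
    by rewrite /adjmx /s map_tperm_mx tr_tperm_mx.
  rewrite !mxE; set i := tperm _ _ _; set l := tperm _ _ _.
  have -> : i = 0 by rewrite /i tpermD //; apply: val_inj.
  suff -> : l = j by [].
  rewrite /l (_ : lshift m 1 = 1 :> 'I_(2 + m)) ?tpermL //; exact: val_inj.
clearbody H1; move: H1 skH1 uH1 uH01 {skH uH uj nj0 us s} => {j}H.
rewrite -[H](@submxK _ 2 m 2 m) block_mxKul.
set P := ulsubmx _; set Q := ursubmx _; set R := dlsubmx _; set T := drsubmx _.
move=> skH uH uP01.
have : @adjmx A star (2 + m) (2 + m) (block_mx P Q R T) = - block_mx P Q R T := skH.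
rewrite adj_block_mx opp_block_mx => /eq_block_mx[skP ER EQ skT].
have uP : P \in unitmx.
  have sP i l : star (P i l) = - P l i.
    by have /matrixP/(_ l i) := skP; rewrite !mxE.
  have r0 : rho (P 0 0) = 0 by apply: (rho_skew AP); apply/skewP; rewrite sP.
  rewrite unitmxE det2 (unit_chainE AP) rmorphB !rmorphM r0 mul0r sub0r oppr_eq0.
  have -> : rho (P 1 0) = - rho (P 0 1) by rewrite -(rho_star AP) sP rmorphN.
  by rewrite mulrN oppr_eq0 mulf_neq0 // -(unit_chainE AP).
(* Block elimination: congruence by [B] clears the off-diagonal blocks and leaves [P] and its Schur
   complement [T']. *)
pose B := block_mx 1%:M (- (invmx P *m Q)) 0 1%:M.
have uB : B \in unitmx by rewrite unitmxE det_ublock !det1 mulr1 unitr1.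
apply: (transposable_congr uB).
pose T' := T - R *m invmx P *m Q.
have aV : adj (invmx P) = - invmx P.
  apply: (can_inj (mulmxK uP)); rewrite mulNmx mulVmx //.
  by rewrite -[X in _ *m X]opprK -skP mulmxN -adjmxM mulmxV // adjmx1.
have EB : adj B *m block_mx P Q R T *m B = block_mx P 0 0 T'.
  rewrite adj_block_mx adjmx0 !adjmx1 adjmxN adjmxM aV.
  rewrite !mulmx_block !(mul1mx, mulmx1, mul0mx, mulmx0, addr0, add0r).
  rewrite EQ !(mulNmx, mulmxN, opprK) -mulmxA mulVmx // mulmx1 addNr mul0mx.
  rewrite mulmxA mulmxV // mul1mx addNr oppr0 add0r.
  by rewrite addrC.
rewrite EB.
have skT' : adj T' = - T'.
  rewrite adjmxD adjmxN !adjmxM aV skT ER EQ.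
  by rewrite !(mulNmx, mulmxN) !opprK mulmxA opprB addrC.
have uT' : T' \in unitmx.
  have : block_mx P 0 0 T' \in unitmx.
    by rewrite -EB !unitmx_mul adjmx_unit uB uH.
  by rewrite !unitmxE det_ublock unitrM => /andP[].
have [D2 ED2] := transposable2 skP uP01.
have [|D ED] := IH _ T' _ skT' uT'; first by rewrite ltnW.
exists (block_mx D2 0 0 D).
rewrite adj_block_mx !adjmx0 !mulmx_block !(mul0mx, mulmx0, addr0, add0r).
by rewrite tr_block_mx ED2 ED !trmx0.
Qed.
End TransposeCongruence.

(** * Transitivity of the special unitary group *)

Record skew_form (A : finComUnitRingType) (star : A -> A) (m : nat)
    (h : 'cV[A]_m -> 'cV[A]_m -> A) : Prop := SkewForm {
  formDr : forall u v w, h u (v + w) = h u v + h u w;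
  formZr : forall u a v, h u (a *: v) = a * h u v;
  formC : forall u v, h v u = - star (h u v);
  form_nondeg : forall u, (forall v, h u v = 0) -> u = 0
}.

Section SkewHermitianSpace.
Variables (A : finComUnitRingType) (star : {rmorphism A -> A}) (pi : A).
Variables (F : finFieldType) (rho : {rmorphism A -> F}) (k : nat).
Hypothesis AP : ramified_chain_ring star pi rho k.
Variables (m : nat) (h : 'cV[A]_m -> 'cV[A]_m -> A).
Hypothesis hP : skew_form star h.
Local Notation adj := (adjmx star).

Let hDr := formDr hP.
Let hZr := formZr hP.
Let hC := formC hP.
Let starK := chain_starK AP.

Lemma formDl u v w : h (u + v) w = h u w + h v w.
Proof. by rewrite hC hDr rmorphD opprD -!hC. Qed.

Lemma formZl a u v : h (a *: u) v = star a * h u v.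
Proof. by rewrite hC hZr rmorphM -mulrN -hC. Qed.

Lemma form0r u : h u 0 = 0.
Proof. by rewrite -(scale0r 0) hZr mul0r. Qed.

Lemma form0l u : h 0 u = 0.
Proof. by rewrite hC form0r rmorph0 oppr0. Qed.

Lemma formNr u v : h u (- v) = - h u v.
Proof. by rewrite -scaleN1r hZr mulN1r. Qed.

Lemma formNl u v : h (- u) v = - h u v.
Proof. by rewrite hC formNr rmorphN -hC. Qed.

Lemma formBr u v w : h u (v - w) = h u v - h u w.
Proof. by rewrite hDr formNr. Qed.

Lemma formBl u v w : h (u - v) w = h u w - h v w.
Proof. by rewrite formDl formNl. Qed.

Definition formE := (formDl, formZl, formNl, formDr hP, formZr hP, formNr).

Lemma form_sumr I (r : seq I) u (v : I -> 'cV[A]_m) :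
  h u (\sum_(i <- r) v i) = \sum_(i <- r) h u (v i).
Proof. by rewrite (big_morph (h u) (hDr u) (form0r u)). Qed.

Lemma form_suml I (r : seq I) (u : I -> 'cV[A]_m) v :
  h (\sum_(i <- r) u i) v = \sum_(i <- r) h (u i) v.
Proof. by rewrite (big_morph (h^~ v) (fun a b => formDl a b v) (form0l v)). Qed.

Lemma star_form u v : star (h u v) = - h v u.
Proof. by rewrite (hC u v) opprK. Qed.

Lemma form_skew u : skew star (h u u).
Proof. by apply/skewP; rewrite star_form. Qed.

Lemma form_unitC u v : (h u v \is a GRing.unit) = (h v u \is a GRing.unit).
Proof. by rewrite (hC v u) unitrN !(unit_chainE AP) (rho_star AP). Qed.

Definition gram : 'M[A]_m :=
  \matrix_(i, j) h (delta_mx i 0) (delta_mx j 0).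

Lemma gramE u v : h u v = (adj u *m gram *m v) 0 0.
Proof.
have cvE (w : 'cV[A]_m) : w = \sum_i w i 0 *: delta_mx i 0.
  by rewrite {1}[w]matrix_sum_delta; apply: eq_bigr => i _; rewrite big_ord1.
rewrite {1}[u]cvE {1}[v]cvE form_sumr mxE; apply: eq_bigr => j _.
rewrite form_suml mxE mulr_suml; apply: eq_bigr => i _.
by rewrite !mxE !formE; ring.
Qed.

Lemma gram_adj : adj gram = - gram.
Proof. by apply/matrixP=> i j; rewrite !mxE star_form. Qed.

Lemma gram_unit : gram \in unitmx.
Proof.
apply: finmx_unit => v v0; apply: (form_nondeg hP) => u.
by rewrite hC gramE -mulmxA v0 mulmx0 mxE rmorph0 oppr0.
Qed.

Definition prim (v : 'cV[A]_m) : bool := [exists z, h v z == 1].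

Lemma prim_unit v z : h v z \is a GRing.unit -> prim v.
Proof.
by move=> u; apply/existsP; exists ((h v z)^-1 *: z); rewrite hZr mulVr.
Qed.

Lemma primP v : reflect (exists z, h v z = 1) (prim v).
Proof. by apply: (iffP existsP) => -[z E]; exists z; apply/eqP. Qed.

(** If [v] pairs to non-units with all basis vectors, then [adj v *m gram] vanishes modulo [pi]; as
    the Gram matrix is invertible, so do the entries of [v]. *)
Lemma nonprim_pi v : ~~ prim v -> exists w, v = pi *: w.
Proof.
move=> np; have /fin_all_exists[w Ew] i : exists x, v i 0 = pi * x.
  have Ev : v i 0 = star ((adj v) 0 i) by rewrite !mxE starK.
  apply: (rho0P AP); rewrite Ev (rho_star AP) -[adj v](mulmxK gram_unit) mxE.
  rewrite rmorph_sum big1 // => j _.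
  rewrite rmorphM; suff -> : rho ((adj v *m gram) 0 j) = 0 by rewrite mul0r.
  have -> : (adj v *m gram) 0 j = h v (delta_mx j 0).
    by rewrite gramE -colE [RHS]mxE.
  apply/eqP; apply: contraNT np; rewrite -(unit_chainE AP); exact: prim_unit.
by exists (\col_i w i); apply/colP=> i; rewrite !mxE Ew.
Qed.

Lemma exists_prim : (0 < m)%N -> exists v, prim v.
Proof.
move=> m_gt0; exists (delta_mx (Ordinal m_gt0) 0).
apply: contraT => /nonprim_pi[w /matrixP/(_ (Ordinal m_gt0) 0)].
rewrite !mxE !eqxx => /(congr1 rho)/eqP.
by rewrite rmorphM (rho_pi AP) mul0r rmorph1 oner_eq0.
Qed.

Lemma prim_decomposition v : (0 < m)%N ->
  exists i w, [/\ (i <= k.*2.+1)%N, prim w & v = pi ^+ i *: w].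
Proof.
move=> m_gt0; have [v0 pv0] := exists_prim m_gt0.
suff key j : (j <= k.*2.+1)%N ->
    (exists i w, [/\ (i <= k.*2.+1)%N, prim w & v = pi ^+ i *: w])
    \/ exists w, v = pi ^+ j *: w.
  (* After [k.*2.+1] divisions by [pi] the vector must be 0, and any primitive vector represents
     it. *)
  have [//|[w Ew]] := key _ (leqnn _); exists k.*2.+1, v0; split => //.
  by rewrite Ew (chain_pi_nil AP) !scale0r.
elim: j => [|i IH] lti; first by right; exists v; rewrite scale1r.
have [|[w Ew]] := IH (ltnW lti); first by left.
have [pw|/nonprim_pi[w' Ew']] := boolP (prim w).
  by left; exists i, w; split; rewrite // ltnW.
by right; exists w'; rewrite Ew Ew' scalerA exprSr.
Qed.

Definition isometry (M : 'M[A]_m) : Prop :=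
  forall u v, h (M *m u) (M *m v) = h u v.

Lemma isometry_unit M : isometry M -> M \in unitmx.
Proof.
move=> iM; apply: finmx_unit => v Mv0; apply: (form_nondeg hP) => u.
by rewrite -iM Mv0 form0l.
Qed.

Lemma isometryM M N : isometry M -> isometry N -> isometry (M *m N).
Proof. by move=> iM iN u v; rewrite -!mulmxA iM iN. Qed.

Lemma isometryV M : isometry M -> isometry (invmx M).
Proof.
move=> iM u v; have uM := isometry_unit iM.
by rewrite -iM !mulmxA mulmxV // !mul1mx.
Qed.

Lemma isometry_prim M v : isometry M -> prim v -> prim (M *m v).
Proof.
by move=> iM /primP[z hz]; apply/primP; exists (M *m z); rewrite iM.
Qed.

(** Matrix of [v |-> v + c h(u, v) u]. The vector [u] need not be isotropic, so these maps include
    quasi-reflections as well as transvections. *)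
Definition transv (c : A) (u : 'cV[A]_m) : 'M[A]_m :=
  1%:M + c *: (u *m (adj u *m gram)).

Lemma transvE c u v : transv c u *m v = v + (c * h u v) *: u.
Proof.
rewrite /transv mulmxDl mul1mx -scalemxAl -mulmxA gramE -scalerA.
by congr (_ + _ *: _); rewrite -mul_mx_scalar; congr (_ *m _); apply/matrixP=> i j;
  rewrite !ord1 [RHS]mxE mulr1n.
Qed.

Lemma transv_isometry c u :
  star c - c + star c * c * h u u = 0 -> isometry (transv c u).
Proof.
move=> Ec v w; rewrite !transvE !formE !rmorphM !star_form.
transitivity (h v w - (star c - c + star c * c * h u u) * h v u * h u w).
  by ring.
by rewrite Ec !mul0r subr0.
Qed.

(** Take [u = w - v] and [c = (h u v)^-1]. Norms are skew, hence non-units, so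
    [h u v = h w v - h v v] is a unit; equality of norms gives [h u u = - h u v - h v u], which is
    the isometry condition for this [c]. *)
Lemma transv_map v w : h v v = h w w -> h w v \is a GRing.unit ->
  exists c u, [/\ isometry (transv c u), transv c u *m v = w & prim u].
Proof.
move=> Evw uwv; pose u := w - v.
have Ehuv : h u v = h w v - h v v by rewrite /u formBl.
have uhuv : h u v \is a GRing.unit.
  move: uwv; rewrite Ehuv !(unit_chainE AP) rmorphB (rho_skew AP (form_skew v)).
  by rewrite subr0.
exists (h u v)^-1, u; split; last exact: prim_unit uhuv.
  apply: transv_isometry; rewrite rmorphV //= star_form.
  have uhvu : - h v u \is a GRing.unit by rewrite unitrN form_unitC.
  apply: (mulrI uhvu); apply: (mulrI uhuv); rewrite !mulr0.
  have -> : h u u = - h u v - h v u.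
    by rewrite /u !formE Evw; ring.
  transitivity ((- h v u * (- h v u)^-1) * h u v - (h u v * (h u v)^-1) * (- h v u)
    + (- h v u * (- h v u)^-1) * (h u v * (h u v)^-1) * (- h u v - h v u)).
    by ring.
  by rewrite !divrr //; ring.
by rewrite transvE mulVr // scale1r /u addrC subrK.
Qed.

(** For skew [a] the norm of [x + a *: y] is [h x x + 2 a - a ^+ 2 * h y y], so [skew_quadratic]
    solves for [a]. As [pi ^+ i * a = 0], the vector [pi ^+ i *: x] is unchanged; for [i = k.*2.+1]
    any skew norm [d] can be reached. *)
Lemma adjust_norm i x y d : h x y = 1 -> skew star d ->
    pi ^+ i * (d - h x x) = 0 ->
  exists a, [/\ skew star a, pi ^+ i * a = 0 & h (x + a *: y) (x + a *: y) = d].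
Proof.
move=> hxy sd pd.
have [|a [sa pa Ea]] := skew_quadratic AP (form_skew y) _ pd.
  apply/skewP; rewrite rmorphB (skewP _ _ sd) (skewP _ _ (form_skew x)); ring.
exists a; split=> //; rewrite !formE hxy (hC x y) hxy rmorph1 (skewP _ _ sa).
by rewrite -[d](subrK (h x x)) -Ea; ring.
Qed.

(** When [h w v] is not a unit, [transv_map] does not apply to [v] and [w] directly; it does apply
    from [v] to [x] and from [x] to [w]. *)
Lemma intermediate v w : prim v -> prim w -> h v v = h w w ->
  exists x, [/\ h x x = h v v, h x v \is a GRing.unit & h w x \is a GRing.unit].
Proof.
move=> /primP[z hz] /primP[t ht] Evw.
have [x0 [ux0 uy0]] : exists x, h v x \is a GRing.unit /\ h w x \is a GRing.unit.
  have [u1|n1] := boolP (h w z \is a GRing.unit).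
    by exists z; rewrite hz unitr1.
  have [u2|n2] := boolP (h v t \is a GRing.unit).
    by exists t; rewrite ht unitr1.
  (* If neither [z] nor [t] pairs to a unit with both vectors, their sum does: each pairing is 1
     plus a non-unit. *)
  exists (z + t); rewrite !hDr hz ht; move: n1 n2.
  rewrite !(unit_chainE AP) !negbK !rmorphD rmorph1 => /eqP-> /eqP->.
  by rewrite addr0 add0r oner_eq0.
pose x := - (h v x0)^-1 *: x0.
have hvx : h v x = -1 by rewrite hZr mulNr mulVr.
have hxv : h x v = 1 by rewrite hC hvx rmorphN1 opprK.
have uwx : h w x \is a GRing.unit by rewrite hZr unitrMl // unitrN unitrV.
clearbody x.
have [||a [sa _ Ea]] := @adjust_norm k.*2.+1 x v (h v v) hxv.
- exact: form_skew.
- by rewrite (chain_pi_nil AP) mul0r.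
exists (x + a *: v); split=> //.
  rewrite !formE hxv (unit_chainE AP) rmorphD rmorphM (rho_skew AP (form_skew v)).
  by rewrite mulr0 addr0 rmorph1 oner_eq0.
rewrite !formE (unit_chainE AP) rmorphD rmorphM (rho_skew AP sa) mul0r addr0.
by rewrite -(unit_chainE AP).
Qed.

Lemma isometry_transitive v w : prim v -> prim w -> h v v = h w w ->
  exists2 M, isometry M & M *m v = w.
Proof.
move=> pv pw Evw; have [x [Ex uxv uwx]] := intermediate pv pw Evw.
have [c [u [i1 E1 _]]] := transv_map (esym Ex) uxv.
have [c' [u' [i2 E2 _]]] := transv_map (etrans Ex Evw) uwx.
exists (transv c' u' *m transv c u); first exact: isometryM.
by rewrite -mulmxA E1.
Qed.

(** The map [p] projects onto the orthogonal of [w]. If it met only non-units there, the Gram matrix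
    modulo [pi] would be a sum of two matrices of rank at most 1, although it is invertible of size
    [m > 2]. *)
Lemma perp_hyperbolic_pair w : (2 < m)%N -> prim w ->
  exists x y, [/\ h w x = 0, h w y = 0 & h x y = 1].
Proof.
move=> m_gt2 /primP[z hz].
pose p v := v - h w v *: z.
have hp v : h w (p v) = 0 by rewrite formBr hZr hz mulr1 subrr.
have [/existsP[u /existsP[v uv]]|/existsPn no] :=
    boolP [exists u, exists v, h (p u) (p v) \is a GRing.unit].
  exists (p u), ((h (p u) (p v))^-1 *: p v).
  by rewrite !hZr !hp mulr0 mulVr.
have rho0 u v : rho (h (p u) (p v)) = 0.
  by have /existsPn/(_ v) := no u; rewrite (unit_chainE AP) negbK => /eqP.
pose a := \col_i rho (h (delta_mx i 0) z); pose b := \row_j rho (h w (delta_mx j 0)).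
pose c := \col_i rho (h w (delta_mx i 0)); pose e := \row_j rho (h z (delta_mx j 0)).
have Egram : map_mx rho gram = a *m b + c *m e.
  apply/matrixP=> i j; rewrite !mxE !big_ord1 !mxE.
  have := rho0 (delta_mx i 0) (delta_mx j 0).
  rewrite /p !formE !(rmorphD, rmorphN, rmorphM) /= !(rho_star AP).
  rewrite (rho_skew AP (form_skew z)) !(mulr0, oppr0, addr0).
  move=> E; rewrite -[LHS]subr0 -{1}E; ring.
have : \rank (map_mx rho gram) = m.
  apply/eqP; rewrite -/(row_free _) row_free_unit unitmxE det_map_mx.
  by rewrite rmorph_unit // -unitmxE gram_unit.
rewrite Egram => rk; suff : (m <= 2)%N by rewrite leqNgt m_gt2.
rewrite -{1}rk (leq_trans (mxrank_add _ _)) // (@leq_add _ _ 1 1) //.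
  exact: leq_trans (mxrankM_maxl _ _) (rank_leq_col _).
exact: leq_trans (mxrankM_maxl _ _) (rank_leq_col _).
Qed.

(** The determinant of the map [T] along [u] is corrected by a conjugate: an isometry [g] carries
    [u] to a vector [u'] of the same norm orthogonal to [w], so [T' = g T g^-1] fixes [w] and has
    the determinant of [T]. *)
Lemma special_step v w : (2 < m)%N -> prim w -> h v v = h w w ->
  h w v \is a GRing.unit ->
  exists M, [/\ isometry M, \det M = 1 & M *m v = w].
Proof.
move=> m_gt2 pw Evw uwv; have [c [u [iT ET pu]]] := transv_map Evw uwv.
have [x [y [wx wy hxy]]] := perp_hyperbolic_pair m_gt2 pw.
have [||a [sa _ Ea]] := @adjust_norm k.*2.+1 x y (h u u) hxy.
- exact: form_skew.
- by rewrite (chain_pi_nil AP) mul0r.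
set u' := x + a *: y in Ea.
have wu' : h w u' = 0 by rewrite /u' hDr hZr wx wy mulr0 addr0.
have pu' : prim u'.
  apply: (@prim_unit _ y); rewrite !formE hxy (unit_chainE AP) rmorphD rmorphM.
  by rewrite (rho_skew AP (form_skew y)) mulr0 addr0 rmorph1 oner_eq0.
have [g ig Eg] := isometry_transitive pu pu' (esym Ea).
have ug := isometry_unit ig.
set T := transv c u in iT ET; pose T' := g *m T *m invmx g.
have iT' : isometry T' by apply/isometryM/isometryV => //; apply: isometryM.
have T'w : T' *m w = w.
  have Egw : h u (invmx g *m w) = 0.
    by rewrite -ig Eg mulmxA mulmxV // mul1mx hC wu' rmorph0 oppr0.
  by rewrite /T' -!mulmxA transvE Egw mulr0 scale0r addr0 mulmxA mulmxV // mul1mx.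
have uT' := isometry_unit iT'.
exists (invmx T' *m T); split.
- exact: isometryM (isometryV iT') iT.
- have dT : \det T \is a GRing.unit by rewrite -unitmxE isometry_unit.
  have dg : \det g \is a GRing.unit by rewrite -unitmxE.
  rewrite det_mulmx det_inv /T' !det_mulmx det_inv [\det g * _]mulrC mulrK //.
  by rewrite mulVr.
- by rewrite -mulmxA ET -{1}T'w mulmxA mulVmx // mul1mx.
Qed.

Lemma special_transitive v w : (2 < m)%N -> prim v -> prim w -> h v v = h w w ->
  exists M, [/\ isometry M, \det M = 1 & M *m v = w].
Proof.
move=> m_gt2 pv pw Evw; have [x [Ex uxv uwx]] := intermediate pv pw Evw.
have px : prim x by apply: prim_unit uxv.
have [M [iM dM EM]] := special_step m_gt2 px (esym Ex) uxv.
have [|N [iN dN EN]] := special_step m_gt2 pw _ uwx; first by rewrite Ex.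
exists (N *m M); rewrite det_mulmx dM dN mulr1 -mulmxA EM.
by split=> //; apply: isometryM.
Qed.
End SkewHermitianSpace.

(** * The orbit invariant *)

Section OrbitInvariant.
Variables (A : finComUnitRingType) (star : {rmorphism A -> A}) (pi : A).
Variables (F : finFieldType) (rho : {rmorphism A -> F}) (k : nat).
Hypothesis AP : ramified_chain_ring star pi rho k.
Variables (m : nat) (h : 'cV[A]_m -> 'cV[A]_m -> A).
Hypothesis hP : skew_form star h.
Local Notation adj := (adjmx star).
Local Notation prim := (prim h).
Local Notation isometry := (isometry h).

(** The annihilator of [pi] consists of multiples of [pi ^+ k.*2]; the exponent being even, all of
    them are fixed by [star], and an element both fixed and skew is 0. *)
Lemma skew_ann_pi a : skew star a -> pi * a = 0 -> a = 0.
Proof.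
move=> /skewP sa pa0.
have [b Eb] : exists b, a = pi ^+ k.*2 * b.
  suff ann j : (j <= k.*2)%N -> exists b, a = pi ^+ j * b by apply: ann.
  elim: j => [|j IH] ltj; first by exists a; rewrite mul1r.
  have [b Eb] := IH (ltnW ltj); have [/(rho0P AP)[b' Eb']|nb] := eqVneq (rho b) 0.
    by exists b'; rewrite Eb Eb' exprSr mulrA.
  have ub : b \is a GRing.unit by rewrite (unit_chainE AP).
  have /eqP : pi ^+ j.+1 = 0 by apply: (mulIr ub); rewrite mul0r exprS -mulrA -Eb.
  by rewrite (pi_exp_eq0 AP) ltnNge ltj.
have [e [e' [Ee _ Eb']]] := chain_split AP b.
have Ea : a = pi ^+ k.*2 * e.
  rewrite Eb Eb' mulrDr [e' * pi]mulrC mulrA -exprSr (chain_pi_nil AP) mul0r.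
  by rewrite addr0.
apply: (mul2_eq0 AP); rewrite -[X in X + _]opprK -sa Ea rmorphM Ee (star_piX AP).
by rewrite -muln2 mulnC exprM sqrrN !expr1n mul1r addNr.
Qed.

(** If the trace of [h w v] vanishes then [h w v] is skew, and replacing [w] by [pi *: w] gives the
    trace [- 2 pi * h w v], nonzero by [skew_ann_pi]. *)
Lemma trace_nondeg v : v != 0 -> exists w, h w v + star (h w v) != 0.
Proof.
move=> nv0; have [w hwv] : exists w, h w v != 0.
  apply/existsP; apply: contra_neqT nv0 => /existsPn no.
  apply: (form_nondeg hP) => w; rewrite (formC hP) (_ : h w v = 0) ?rmorph0 ?oppr0 //.
  by apply/eqP; have := no w; rewrite negbK.
have [E|] := eqVneq (h w v + star (h w v)) 0; last by exists w.
have sk : skew star (h w v) by rewrite /skew -addr_eq0 addrC E.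
exists (pi *: w); apply: contra hwv => /eqP.
rewrite (formZl hP) (chain_star_pi AP) rmorphM rmorphN /= (chain_star_pi AP).
rewrite (skewP _ _ sk) opprK mulrN mulNr => /(mul2_eq0 AP)/eqP.
by rewrite oppr_eq0 => /eqP/(skew_ann_pi sk)->.
Qed.

(* A vector [pi ^+ i *: w] with [w] primitive determines [w] up to the
   annihilator of [pi ^+ i], hence also [pi ^+ i * h w w]. *)
Definition has_level (v : 'cV[A]_m) (x : 'I_k.*2.+2 * A) : bool :=
  [exists w, [&& prim w, v == pi ^+ x.1 *: w & x.2 == pi ^+ x.1 * h w w]].

Lemma has_levelP v i z : reflect
  (exists w, [/\ prim w, v = pi ^+ (i : 'I_k.*2.+2) *: w & z = pi ^+ i * h w w])
  (has_level v (i, z)).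
Proof.
apply: (iffP existsP) => -[w]; first by case/and3P=> pw /eqP Ev /eqP Ez; exists w.
by case=> pw -> ->; exists w; rewrite pw !eqxx.
Qed.

Lemma has_level_exists v : (0 < m)%N -> exists x, has_level v x.
Proof.
move/(prim_decomposition AP hP v) => [i [w [lti pw Ev]]].
by exists (Ordinal (lti : (i < k.*2.+2)%N), pi ^+ i * h w w); apply/has_levelP; exists w.
Qed.

Lemma prim_pi_eq0 i w : prim w -> pi ^+ i *: w = 0 -> (k.*2 < i)%N.
Proof.
move=> /primP[z hz] E; rewrite -(pi_exp_eq0 AP).
have := congr1 (fun w => h w z) E; rewrite (formZl hP) hz mulr1 (form0l hP).
by move=> /(congr1 star); rewrite (chain_starK AP) rmorph0 => ->.
Qed.

Lemma has_level_unique v x y : has_level v x -> has_level v y -> x = y.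
Proof.
case: x y => i z [j t] /has_levelP[w [pw -> ->]] /has_levelP[w' [pw' E ->]].
have le (i1 i2 : 'I_k.*2.+2) w1 w2 : prim w1 ->
    pi ^+ i1 *: w1 = pi ^+ i2 *: w2 -> (i2 <= i1)%N.
  move=> pw1 E12; rewrite leqNgt; apply/negP => lt12.
  have lei2 : (i2 <= k.*2.+1)%N by rewrite -ltnS.
  (* This power of [pi] kills the right side, but if [i1 < i2] the exponent on the left is at most
     [k.*2], too small to kill a primitive vector. *)
  have /(prim_pi_eq0 pw1) : pi ^+ (k.*2.+1 - i2 + i1) *: w1 = 0.
    rewrite exprD -scalerA E12 scalerA -exprD subnK //.
    by rewrite (chain_pi_nil AP) scale0r.
  by apply/negP; rewrite -leqNgt -ltnS -[X in (_ < X)%N](subnK lei2) ltn_add2l.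
have Eij : i = j.
  by apply/val_inj/eqP; rewrite eqn_leq (le _ _ _ _ pw E) (le _ _ _ _ pw' (esym E)).
rewrite -Eij in E *; congr (_, _).
(* Exchange [w] for [w'] in one argument at a time; in the left one the scalar is conjugated, which
   costs only the sign [(-1) ^+ i]. *)
have E1 : pi ^+ i * h w w = pi ^+ i * h w w' by rewrite -!(formZr hP) E.
have E2 : star (pi ^+ i) * h w w' = star (pi ^+ i) * h w' w'.
  by rewrite -!(formZl hP) E.
rewrite E1; apply: (@mulrI _ ((-1) ^+ i)); first by rewrite unitrX ?unitrN1.
by rewrite !mulrA -(star_piX AP).
Qed.

Lemma has_level_isometry M v x : isometry M -> has_level v x -> has_level (M *m v) x.
Proof.
case: x => i z iM /has_levelP[w [pw -> ->]]; apply/has_levelP; exists (M *m w).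
by rewrite -scalemxAr iM; split=> //; apply: isometry_prim.
Qed.

(** The norms of [w] and [w'] agree only after multiplication by [pi ^+ i]. Changing [w'] by
    [a *: y] with [pi ^+ i * a = 0] makes them equal without moving [pi ^+ i *: w']. *)
Lemma has_level_special v v' x : (2 < m)%N -> has_level v x -> has_level v' x ->
  exists M, [/\ isometry M, \det M = 1 & M *m v = v'].
Proof.
case: x => i z m_gt2 /has_levelP[w [pw -> ->]] /has_levelP[w' [pw' -> E]].
have [y hy] := primP _ _ pw'.
have [||a [sa pa Ea]] := adjust_norm AP hP (i := i) (d := h w w) hy.
- exact: form_skew hP _.
- by rewrite mulrBr E subrr.
have pw'' : prim (w' + a *: y).
  apply: (prim_unit hP (z := y)); rewrite (formDl hP) (formZl hP) hy.
  rewrite (unit_chainE AP) rmorphD rmorphM.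
  by rewrite (rho_skew AP (form_skew hP y)) mulr0 addr0 rmorph1 oner_eq0.
have [M [iM dM EM]] := special_transitive AP hP m_gt2 pw pw'' (esym Ea).
exists M; split=> //; rewrite -scalemxAr EM scalerDr scalerA pa scale0r addr0 //.
Qed.

Definition level v : 'I_k.*2.+2 * A := odflt (ord0, 0) [pick x | has_level v x].

Lemma levelE v x : has_level v x -> level v = x.
Proof.
rewrite /level; case: pickP => [y hy hx | /(_ x)->] //.
exact: has_level_unique hy hx.
Qed.

Lemma levelP v : (0 < m)%N -> has_level v (level v).
Proof. by move/(has_level_exists v) => [x hx]; rewrite (levelE hx). Qed.

Lemma level_special v w : (2 < m)%N -> level v = level w <->
  exists M, [/\ isometry M, \det M = 1 & w = M *m v].
Proof.
move=> m_gt2; have m_gt0 : (0 < m)%N by apply: leq_trans m_gt2.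
split=> [E | [M [iM _ ->]]]; last first.
  by apply/esym/levelE/has_level_isometry/levelP.
have := levelP w m_gt0; rewrite -E => hw.
by have [M [? ? ?]] := has_level_special m_gt2 (levelP v m_gt0) hw; exists M.
Qed.

Lemma level_isometry M v : (0 < m)%N -> isometry M -> level (M *m v) = level v.
Proof. by move=> m_gt0 iM; apply/levelE/has_level_isometry/levelP. Qed.

(** Every skew element is the norm of some primitive vector by [adjust_norm], so the levels are
    exactly the pairs of an [i] and an element of [layer i.+1]. *)
Lemma card_levels : (2 < m)%N ->
  #|level @: setT| = (2 * \sum_(i < k.+1) #|F| ^ i)%N.
Proof.
move=> m_gt2; have m_gt0 : (0 < m)%N by apply: leq_trans m_gt2.
rewrite -(sum_card_layer AP).
have -> : level @: setT = [set x : 'I_k.*2.+2 * A | x.2 \in layer star pi x.1.+1].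
  apply/setP=> -[i z]; rewrite inE; apply/imsetP/imsetP => /= [[v _ Ev]|[e]].
    have /has_levelP[w [pw _ ->]] : has_level v (i, z) by rewrite Ev levelP.
    have [e Ee ->] := skew_pi AP (form_skew hP w).
    by exists e; rewrite ?inE ?Ee // exprSr mulrAC mulrA.
  rewrite inE => /eqP Ee ->.
  have [w0 pw0] := exists_prim AP hP m_gt0; have [y hy] := primP _ _ pw0.
  have [||a [sa pa Ea]] :=
      adjust_norm AP hP (i := k.*2.+1) (d := e * pi) hy.
  - exact: fix_pi_skew AP _ Ee.
  - by rewrite (chain_pi_nil AP) mul0r.
  exists (pi ^+ i *: (w0 + a *: y)) => //; apply/esym/levelE/has_levelP.
  exists (w0 + a *: y); split=> //; last by rewrite Ea exprSr mulrAC mulrA.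
  apply: (prim_unit hP (z := y)); rewrite (formDl hP) (formZl hP) hy.
  rewrite (unit_chainE AP) rmorphD rmorphM.
  by rewrite (rho_skew AP (form_skew hP y)) mulr0 addr0 rmorph1 oner_eq0.
rewrite -sum1_card; under [RHS]eq_bigr do rewrite -sum1_card.
by rewrite pair_big_dep; apply: eq_bigl => -[i z]; rewrite inE.
Qed.

Lemma exists_anti_isometry : (0 < m)%N -> exists sigma : 'cV[A]_m -> 'cV[A]_m,
  [/\ forall u v, sigma (u - v) = sigma u - sigma v,
      injective sigma, forall u v, h (sigma u) (sigma v) = h v u
    & forall v, level (sigma v) = level v].
Proof.
move=> m_gt0.
have [D ED] := skew_mx_transposable AP (gram_adj hP) (gram_unit hP).
pose sigma (v : 'cV[A]_m) := D *m map_mx star v.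
have sB u v : sigma (u - v) = sigma u - sigma v by rewrite /sigma map_mxB mulmxBr.
have sZ a v : sigma (a *: v) = star a *: sigma v.
  by rewrite /sigma map_mxZ scalemxAr.
have hs u v : h (sigma u) (sigma v) = h v u.
  rewrite !(gramE hP) /sigma adjmxM !mulmxA.
  have -> : adj (map_mx star u) = u^T.
    by apply/matrixP=> i j; rewrite !mxE (chain_starK AP).
  have -> : u^T *m adj D *m gram h *m D *m map_mx star v =
            u^T *m (adj D *m gram h *m D) *m map_mx star v by rewrite !mulmxA.
  rewrite ED.
  have trE (M : 'M[A]_1) : M^T 0 0 = M 0 0 by rewrite mxE.
  by rewrite -[RHS]trE !trmx_mul trmxK mulmxA.
exists sigma; split=> //.
  move=> u v /eqP; rewrite -subr_eq0 -sB => /eqP E; apply/eqP; rewrite -subr_eq0.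
  apply/eqP/(form_nondeg hP) => w.
  by rewrite -hs E (form0r hP).
move=> v; apply: levelE; have := levelP v m_gt0; case: (level v) => i z.
(* [sigma] is semilinear, so [sigma (pi ^+ i *: w)] carries the sign [(-1) ^+ i]; it is absorbed
   into the primitive vector. *)
case/has_levelP=> w [pw -> ->]; apply/has_levelP; exists ((-1) ^+ i *: sigma w).
have s1 : star ((-1) ^+ i) = (-1) ^+ i by rewrite rmorphXn rmorphN1.
have sqr1 : (-1) ^+ i * (-1) ^+ i = 1 :> A by rewrite -expr2 sqrr_sign.
split.
- have [y hy] := primP _ _ pw; apply: (prim_unit hP (z := sigma y)).
  rewrite (formZl hP) hs s1 unitrMr; last by rewrite unitrX ?unitrN1.
  by rewrite (form_unitC AP hP) hy unitr1.
- by rewrite sZ (star_piX AP) scalerA mulrC.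
- by rewrite (formZl hP) (formZr hP) s1 (mulrA ((-1) ^+ i)) sqr1 mul1r hs.
Qed.
End OrbitInvariant.

(** * Commutative commutants *)

Lemma proj_mx_cent (C : fieldType) (gT : finGroupType) (G : {group gT}) (d : nat)
    (rG : mx_representation C G d) (U V : 'M_d) :
  mxmodule rG U -> mxmodule rG V -> (U :&: V = 0)%MS -> (1%:M <= U + V)%MS ->
  centgmx rG (proj_mx U V).
Proof.
move=> mU mV dUV sUV; apply/centgmxP => g Gg.
have /hom_mxP/(_ g Gg) := submx_trans sUV (proj_mx_hom dUV mU mV).
by rewrite !mul1mx => ->.
Qed.

Section CommutativeCommutant.
Variables (C : closedFieldType) (gT : finGroupType) (G : {group gT}) (d : nat).
Variable rG : mx_representation C G d.
Hypothesis pcharG : pgroup.pgroup ([pchar C]^') G.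

Lemma mxmodule_complement (U : 'M_d) : mxmodule rG U ->
  exists V : 'M_d, [/\ mxmodule rG V, (U :&: V = 0)%MS & (1%:M <= U + V)%MS].
Proof.
move=> mU; have [V mV eV dV] := mx_Maschke_pchar rG pcharG mU (submx1 U).
by exists V; split; rewrite ?eV //; apply/mxdirect_addsP.
Qed.

Hypothesis cent_comm : forall f f' : 'M_d,
  centgmx rG f -> centgmx rG f' -> f *m f' = f' *m f.

(** Otherwise [M] and [M'] are independent. With [e] the projection onto [M] along [M'] and a
    complement, [e] and [e *m f] are in the commutant, yet [e *m (e *m f) = e *m f] while
    [(e *m f) *m e = 0]. Commutativity then makes [f] vanish on [M]. *)
Lemma mx_iso_simple_eqmx (M M' : 'M_d) :
  mxsimple rG M -> mxsimple rG M' -> mx_iso rG M M' -> (M :=: M')%MS.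
Proof.
move=> sM sM' [f _ hf eMf]; have [mM nzM minM] := sM; have [mM' nzM' minM'] := sM'.
have [dMM' | ndMM'] := eqVneq (M :&: M')%MS 0; last first.
  have mI : mxmodule rG (M :&: M')%MS by rewrite capmx_module.
  apply/eqmxP/andP; split.
    by apply: submx_trans (minM _ mI (capmxSl _ _) ndMM') (capmxSr _ _).
  by apply: submx_trans (minM' _ mI (capmxSr _ _) ndMM') (capmxSl _ _).
have mS : mxmodule rG (M + M')%MS by rewrite addsmx_module.
have [V [mV dV sV]] := mxmodule_complement mS.
pose e := proj_mx M (M' + V)%MS.
have dMV : (M :&: (M' + V) = 0)%MS.
  have := mxrank_sum_cap M (M' + V)%MS; rewrite addsmxA.
  have := mxrank_sum_cap (M + M')%MS V; rewrite dV mxrank0 addn0 => ->.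
  have := mxrank_sum_cap M M'; rewrite dMM' mxrank0 addn0 => ->.
  move=> erk; apply/eqP; rewrite -mxrank_eq0 -leqn0.
  rewrite -(leq_add2l (\rank M + \rank M' + \rank V)) erk addn0 -addnA leq_add2l.
  by rewrite (mxrank_adds_leqif M' V).1.
have ce : centgmx rG e.
  by apply: proj_mx_cent => //; rewrite ?addsmx_module // addsmxA.

have seM : (e <= M)%MS by rewrite -[e]mul1mx proj_mx_sub.
have cef : centgmx rG (e *m f).
  apply/centgmxP=> g Gg; have /hom_mxP/(_ g Gg) := submx_trans seM hf.
  by move=> <-; rewrite (centgmxP ce) // -mulmxA.
have ef0 : e *m f = 0.
  have <- : e *m (e *m f) = e *m f by rewrite mulmxA proj_mx_proj.
  rewrite cent_comm // (proj_mx_0 dMV) //.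
  rewrite (submx_trans (submxMr f seM)) // eMf addsmxSl //.
case/eqP: nzM'; apply/eqP; rewrite -submx0 -eMf.
have -> : M *m f = M *m (e *m f) by rewrite mulmxA proj_mx_id.
by rewrite ef0 mulmx0 sub0mx.
Qed.

(** Commuting with the equivariant projection onto [M], [f] stabilizes [M]; Schur's lemma over the
    algebraically closed field applies to its restriction. *)
Lemma cent_simple_scalar (M f : 'M_d) :
  mxsimple rG M -> centgmx rG f -> exists c, M *m f = c *: M.
Proof.
move=> sM cf; have [mM nzM _] := sM.
have [V [mV dV sV]] := mxmodule_complement mM.
have ce := proj_mx_cent mM mV dV sV.
have stM : (M *m f <= M)%MS.
  have -> : M *m f = M *m (f *m proj_mx M V).
    by rewrite (cent_comm cf ce) mulmxA proj_mx_id.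
  by rewrite mulmxA proj_mx_sub.
have irr := group_closure_closed_field ((submod_mx_irr mM).2 sM).
pose f' := in_submod M (val_submod (1%:M : 'M_(\rank M)) *m f).
have vf' k (W : 'M_(k, \rank M)) : val_submod (W *m f') = val_submod W *m f.
  rewrite /f' in_submodE mulmxA -in_submodE mulmxA -val_submodE in_submodK //.
  by rewrite (submx_trans _ stM) ?submxMr ?val_submodP.
have : centgmx (submod_repr mM) f'.
  apply/centgmxP=> g Gg; apply: val_submod_inj.
  rewrite val_submodJ // vf' -[X in val_submod X *m f]mul1mx val_submodJ //.
  by rewrite -[f']mul1mx vf' -!mulmxA (centgmxP cf).
move/(mx_abs_irr_cent_scalar irr)/is_scalar_mxP=> [c Ec]; exists c.
have := vf' _ (in_submod M M); rewrite in_submodK // => <-.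
by rewrite Ec mul_mx_scalar linearZ /= in_submodK.
Qed.

(** The projections [P i] onto the summands of a semisimple decomposition form a second basis of the
    commutant. Comparing ranks of the two flattened bases [MB] and [MP] shows that there are [k]
    summands. *)
Lemma commutative_commutant_decomposition (k : nat) (B : 'I_k -> 'M[C]_d) :
  (forall a : 'I_k -> C, \sum_i a i *: B i = 0 -> forall i, a i = 0) ->
  (forall f : 'M_d, centgmx rG f <-> exists a : 'I_k -> C, f = \sum_i a i *: B i) ->
  exists M : 'I_k -> 'M[C]_d,
    [/\ forall i, mxsimple rG (M i), mxdirect (\sum_i M i)%MS,
        (\sum_i M i :=: 1%:M)%MS
      & forall i j, mx_iso rG (M i) (M j) -> i = j].
Proof.
move=> freeB spanB.
have [I U W sU eU dU] := dec_mx_reducible_semisimple (mxmodule1 rG)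
  (fun V mV sV => mx_Maschke_pchar rG pcharG mV sV); rewrite {}/W in eU dU.
have modU i : mxmodule rG (U i) by case: (sU i).
pose P i := proj_mx (U i) (\sum_(j | j != i) U j)%MS.
have dUi i : (U i :&: \sum_(j | j != i) U j = 0)%MS.
  exact: (mxdirect_sumsP dU).
have UPii i : U i *m P i = U i by rewrite proj_mx_id.
have UPij i j : i != j -> U i *m P j = 0.
  by move=> nij; rewrite proj_mx_0 // (sumsmx_sup i).
have cP i : centgmx rG (P i).
  apply: proj_mx_cent => //; first exact: sumsmx_module.
  by rewrite -eU (bigD1 i).
have P1 : \sum_i P i = 1%:M.
  have /sub_sumsmxP[u Eu] : (1%:M <= \sum_i U i)%MS by rewrite eU.
  transitivity (\sum_i (u i *m U i)); last by rewrite Eu.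
  apply: eq_bigr => i _; rewrite -[P i]mul1mx Eu mulmx_suml (bigD1 i) //=.
  rewrite -mulmxA UPii big1 ?addr0 // => j nji.
  by rewrite -mulmxA UPij // mulmx0.
have PU i : exists w, P i = w *m U i.
  by apply/submxP; rewrite -[P i]mul1mx proj_mx_sub.
have spanP f : centgmx rG f -> exists a : I -> C, f = \sum_i a i *: P i.
  move=> cf; have /fin_all_exists[a Ea] i := cent_simple_scalar (sU i) cf.
  exists a; rewrite -[LHS]mul1mx -P1 mulmx_suml; apply: eq_bigr => i _.
  by have [w ->] := PU i; rewrite -mulmxA Ea scalemxAr.
have freeP (a : I -> C) : \sum_i a i *: P i = 0 -> forall i, a i = 0.
  move=> a0 i; have := congr1 (mulmx (U i)) a0; rewrite mulmx0 mulmx_sumr.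
  rewrite (bigD1 i) //= big1 => [|j nji].
    rewrite addr0 -scalemxAr UPii => /eqP; rewrite scaler_eq0.
    by case: (sU i) => _ /negPf-> _; rewrite orbF => /eqP.
  by rewrite -scalemxAr UPij 1?eq_sym // scaler0.
pose MB := \matrix_(i < k) mxvec (B i).
pose MP := \matrix_(i < #|I|) mxvec (P (enum_val i)).
have mulMB (a : 'rV_k) : a *m MB = mxvec (\sum_i a 0 i *: B i).
  rewrite mulmx_sum_row linear_sum /=; apply: eq_bigr => i _.
  by rewrite rowK linearZ.
have mulMP (a : 'rV_#|I|) :
  a *m MP = mxvec (\sum_i a 0 (enum_rank i) *: P i).
  rewrite mulmx_sum_row linear_sum (reindex (@enum_val I I)) /=; last first.
    by exists enum_rank => ? _; [apply: enum_valK | apply: enum_rankK].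
  by apply: eq_bigr => i _; rewrite rowK linearZ /= enum_valK.
have rB : row_free MB.
  apply: inj_row_free => a; rewrite mulMB => /(canRL mxvecK).
  rewrite linear0 => /freeB a0; apply/rowP => i; rewrite mxE; exact: a0.
have rP : row_free MP.
  apply: inj_row_free => a; rewrite mulMP => /(canRL mxvecK).
  rewrite linear0 => /freeP a0; apply/rowP => i; rewrite mxE.
  by rewrite -(enum_valK i) a0.
have eBP : (MB :=: MP)%MS.
  apply/eqmxP/andP; split; apply/row_subP => i; rewrite rowK; apply/submxP.
    have [|a Ea] := @spanP (B i).
      apply/spanB; exists (fun j => (j == i)%:R).
      rewrite (bigD1 i) //= eqxx scale1r big1 ?addr0 // => j /negPf->.
      by rewrite scale0r.
    exists (\row_j a (enum_val j)); rewrite mulMP {1}Ea; congr mxvec.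
    by apply: eq_bigr => j _; rewrite mxE enum_rankK.
  have [a Ea] := (spanB _).1 (cP (enum_val i)).
  exists (\row_j a j); rewrite mulMB {1}Ea; congr mxvec.
  by apply: eq_bigr => j _; rewrite mxE.
have Ek : #|I| = k by rewrite -(eqP rP) -eBP (eqP rB).
case: _ / Ek {B freeB spanB MB mulMB rB eBP}.
have rsum : (\sum_(i < #|I|) U (enum_val i) :=: \sum_i U i)%MS.
  apply/eqmxP/andP; split; apply/sumsmx_subP => i _.
    exact: sumsmx_sup.
  by rewrite (sumsmx_sup (enum_rank i)) ?enum_rankK.
exists (fun i => U (enum_val i)); split=> //.
- rewrite mxdirectE /= rsum (mxdirectP dU) /= (reindex (@enum_val I I)) //.
  by exists enum_rank => ? _; [apply: enum_valK | apply: enum_rankK].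
- exact: eqmx_trans rsum eU.
move=> i j iso_ij; have [//|nij] := eqVneq i j.
have eUij := mx_iso_simple_eqmx (sU _) (sU _) iso_ij.
have : (U (enum_val i) <= U (enum_val i) :&: \sum_(j | j != enum_val i) U j)%MS.
  rewrite sub_capmx submx_refl eUij (sumsmx_sup (enum_val j)) //.
  by rewrite (inj_eq enum_val_inj) eq_sym.
by rewrite dUi submx0; case: (sU (enum_val i)) => _ /negPf->.
Qed.

End CommutativeCommutant.

(* If every endomorphism of the H-module is already G-equivariant, then the projections
   onto the H-submodules of a G-simple module are G-equivariant. *)
Lemma subg_simple (C : fieldType) (gT : finGroupType) (G H : {group gT}) (d : nat)
    (rG : mx_representation C G d) (sHG : H \subset G) (M : 'M_d) :
  pgroup.pgroup ([pchar C]^') H ->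
  (forall f : 'M_d, centgmx (subg_repr rG sHG) f -> centgmx rG f) ->
  mxsimple rG M -> mxsimple (subg_repr rG sHG) M.
Proof.
move=> pH cHG [mM nzM minM]; split=> // [|U mU sUM nzU].
  by apply/mxmoduleP=> g Hg; apply: (mxmoduleP mM); apply: (subsetP sHG).
apply: minM => //.
have [V mV eV dV] := mx_Maschke_pchar (subg_repr rG sHG) pH mU (submx1 U).
have {}dV : (U :&: V = 0)%MS by apply/mxdirect_addsP.
have ce : centgmx rG (proj_mx U V).
  by apply: cHG; apply: proj_mx_cent => //; rewrite eV.
apply/mxmoduleP=> g Gg; rewrite -{1}[U](proj_mx_id dV (submx_refl U)).
by rewrite -mulmxA (centgmxP ce) // mulmxA proj_mx_sub.
Qed.

(** * Twisted group bases of matrix algebras *)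

Section TwistedGroupBasis.
Variables (C : fieldType) (V : finZmodType) (d : nat).
Variables (S : V -> 'M[C]_d) (phi : V -> V -> C).
Hypothesis S0 : S 0 = 1%:M.
Hypothesis SM : forall u v, S u *m S v = phi u v *: S (u + v).
Hypothesis phi_neq0 : forall u v, phi u v != 0.
Hypothesis phi_nondeg :
  forall x, x != 0 -> exists u v, u + v = x /\ phi u v != phi v u.
Hypothesis d_neq0 : d%:R != 0 :> C.
Hypothesis S_span : forall f : 'M_d, exists a : V -> C, f = \sum_v a v *: S v.

(** [S x *m S y] and [S y *m S x] have equal traces but are distinct multiples of [S v] when
    [v = x + y] is chosen by [phi_nondeg]. *)
Lemma trace_S v : v != 0 -> \tr (S v) = 0.
Proof.
move=> /phi_nondeg[x [y [<- nphi]]].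
have := mxtrace_mulC (S x) (S y); rewrite !SM [y + x]addrC !linearZ /=.
move/eqP; rewrite -subr_eq0 -mulrBl mulf_eq0 subr_eq0 (negPf nphi).
by move/eqP.
Qed.

(** The trace against [S (- v)] isolates [a v], up to the nonzero factor [phi v (- v) * d]. *)
Lemma S_free (a : V -> C) : \sum_v a v *: S v = 0 -> forall v, a v = 0.
Proof.
move=> a0 v; have := congr1 (fun M => \tr (M *m S (- v))) a0.
rewrite mul0mx linear0 mulmx_suml linear_sum (bigD1 v) //= big1 => [|u nuv].
  rewrite -scalemxAl SM subrr S0 !linearZ /= mxtrace1 addr0 => /eqP.
  by rewrite !mulf_eq0 (negPf d_neq0) (negPf (phi_neq0 _ _)) !orbF => /eqP.
by rewrite -scalemxAl SM !linearZ /= trace_S ?mulr0 // subr_eq0.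
Qed.

Lemma S_coef (a b : V -> C) :
  \sum_v a v *: S v = \sum_v b v *: S v -> a =1 b.
Proof.
move/eqP; rewrite -subr_eq0 -sumrB => /eqP ab v; apply/eqP; rewrite -subr_eq0.
rewrite (S_free (a := fun v => a v - b v)) // -[RHS]ab.
by apply: eq_bigr => u _; rewrite scalerBl.
Qed.

Lemma S_mul (a b : V -> C) :
  (\sum_u a u *: S u) *m (\sum_v b v *: S v) =
  \sum_x (\sum_u a u * b (x - u) * phi u (x - u)) *: S x.
Proof.
under [RHS]eq_bigr do rewrite scaler_suml.
rewrite exchange_big mulmx_suml; apply: eq_bigr => u _ /=.
rewrite mulmx_sumr [RHS](reindex_inj (addrI u)); apply: eq_bigr => v _ /=.
by rewrite addrAC subrr add0r -scalemxAl -scalemxAr SM !scalerA.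
Qed.

Section Action.
Variables (gT : finGroupType) (G : {group gT}) (rG : mx_representation C G d).
Variable act : gT -> V -> V.
Hypothesis act_inj : forall g, g \in G -> injective (act g).
Hypothesis rG_S :
  forall g v, g \in G -> rG g *m S v = S (act g v) *m rG g.

Lemma centgmx_coef (a : V -> C) :
  centgmx rG (\sum_v a v *: S v) <->
  (forall g v, g \in G -> a (act g v) = a v).
Proof.
have rGa g b : g \in G ->
    rG g *m (\sum_v b v *: S v) = (\sum_v b v *: S (act g v)) *m rG g.
  move=> Gg; rewrite mulmx_sumr mulmx_suml; apply: eq_bigr => v _.
  by rewrite -scalemxAr rG_S // scalemxAl.
have aE g : g \in G ->
    \sum_v a v *: S v = \sum_v a (act g v) *: S (act g v).
  by move=> Gg; rewrite (reindex_inj (act_inj Gg)).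
split=> [/centgmxP ca g v Gg | ainv].
  have := ca g Gg; rewrite rGa // => /(can_inj (mulmxK (repr_mx_unit rG Gg))).
  have [g' gK g'K] := injF_bij (act_inj Gg).
  have -> : \sum_v a v *: S (act g v) = \sum_v a (g' v) *: S v.
    rewrite [RHS](reindex_inj (act_inj Gg)).
    by apply: eq_bigr => u _; rewrite gK.
  by move/S_coef->; rewrite gK.
apply/centgmxP=> g Gg; rewrite rGa // {1}(aE g Gg); congr (_ *m _).
by apply: eq_bigr => v _; rewrite ainv.
Qed.

Variables (I : finType) (par : V -> I).
Hypothesis parP :
  forall u v, par u = par v <-> exists2 g, g \in G & v = act g u.

Lemma centgmx_par (a : V -> C) :
  centgmx rG (\sum_v a v *: S v) <-> (forall u v, par u = par v -> a u = a v).
Proof.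
split=> [/centgmx_coef ainv u v /parP[g Gg ->]| apar].
  by rewrite ainv.
apply/centgmx_coef => g v Gg.
by apply/esym/apar/parP; exists g.
Qed.

(** Sums over the fibres of [par], which are the [G]-orbits by [parP]. *)
Let T (i : 'I_#|par @: setT|) := \sum_(v | par v == enum_val i) S v.

Let parV v : par v \in par @: setT. Proof. exact: imset_f. Qed.

Let T_sum (a : 'I_#|par @: setT| -> C) :
  \sum_i a i *: T i = \sum_v a (enum_rank_in (parV v) (par v)) *: S v.
Proof.
rewrite [RHS](partition_big (fun v => enum_rank_in (parV v) (par v)) xpredT) //=.
apply: eq_bigr => i _; rewrite scaler_sumr; apply: eq_big => [v|v /eqP Ev].
  by rewrite -(inj_eq enum_val_inj) enum_rankK_in.
by congr (a _ *: _); apply: enum_val_inj; rewrite enum_rankK_in.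
Qed.

Lemma orbit_sums_free (a : 'I_#|par @: setT| -> C) :
  \sum_i a i *: T i = 0 -> forall i, a i = 0.
Proof.
rewrite T_sum => /S_free a0 i; have /imsetP[v _ Ev] := enum_valP i.
rewrite -(a0 v); congr a; apply: enum_val_inj.
by rewrite enum_rankK_in ?parV.
Qed.

Lemma orbit_sums_span (f : 'M_d) :
  centgmx rG f <-> exists a : 'I_#|par @: setT| -> C, f = \sum_i a i *: T i.
Proof.
split=> [|[a ->]].
  have [a ->] := S_span f => /centgmx_par apar.
  exists (fun i => a (odflt 0 [pick v | par v == enum_val i])).
  rewrite T_sum; apply: eq_bigr => v _; congr (_ *: _); apply: apar.
  rewrite enum_rankK_in //; case: pickP => [u /eqP // | /(_ v)].
  by rewrite eqxx.
rewrite T_sum; apply/centgmx_par => u v Euv; congr a; apply: enum_val_inj.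
by rewrite !enum_rankK_in.
Qed.

Variable sigma : V -> V.
Hypothesis sigmaB : forall u v, sigma (u - v) = sigma u - sigma v.
Hypothesis sigma_inj : injective sigma.
Hypothesis phi_sigma : forall u v, phi (sigma u) (sigma v) = phi v u.
Hypothesis par_sigma : forall v, par (sigma v) = par v.

(* [S v |-> S (sigma v)] is an anti-automorphism of the matrix algebra that
   fixes the commutant pointwise. *)
Lemma commutant_comm (f f' : 'M_d) :
  centgmx rG f -> centgmx rG f' -> f *m f' = f' *m f.
Proof.
have [a ->] := S_span f; have [b ->] := S_span f' => ca cb.
have : centgmx rG ((\sum_v a v *: S v) *m (\sum_v b v *: S v)).
  apply/centgmxP=> g Gg.
  by rewrite -mulmxA (centgmxP cb) // !mulmxA (centgmxP ca).
rewrite !S_mul => /centgmx_par cab; apply: eq_bigr => x _; congr (_ *: _).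
(* Read the left coefficient at [sigma x], substitute [sigma u] for [u] there and [x - u] for [u] on
   the right; [phi_sigma] then identifies the two sums term by term. *)
rewrite -(cab _ _ (par_sigma x)) (reindex_inj sigma_inj).
rewrite [RHS](reindex_inj (inv_inj (subKr x))).
apply: eq_bigr => u _; rewrite -sigmaB phi_sigma subKr.
rewrite ((centgmx_par a).1 ca _ _ (par_sigma u)).
by rewrite ((centgmx_par b).1 cb _ _ (par_sigma (x - u))) (mulrC (a u)).
Qed.
End Action.
End TwistedGroupBasis.

(** * The chain ring of a ramified quadratic extension *)

Section RamifiedQuotient.
Variables (O : idomainType) (s : O) (Fq : finFieldType) (res : {rmorphism O -> Fq}).
Variables (k : nat) (Q : quotient_rings s k.+1).
Hypothesis sP : local_pid s.
Hypothesis resP : is_quotient res (principal s).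
Hypothesis pchar2 : 2%N \notin [pchar Fq].

Local Notation cst := (ram_const s).
Local Notation t := (ram_t s).

Lemma ram_constD a b : cst (a + b) = cst a + cst b.
Proof. exact: rmorphD. Qed.

Lemma ram_constN a : cst (- a) = - cst a.
Proof. exact: rmorphN. Qed.

Lemma ram_const0 : cst 0 = 0.
Proof. exact: rmorph0. Qed.

Lemma ram_const1 : cst 1 = 1.
Proof. exact: rmorph1. Qed.

Lemma ram_constX a i : cst (a ^+ i) = cst a ^+ i.
Proof. exact: rmorphXn. Qed.

Definition const_coef (x : ramified s) : O := (x : {poly O})`_0.

Lemma const_coefE a b : const_coef (cst a + cst b * t) = a.
Proof. by rewrite /const_coef ram_pairE coefD coefMX coefC /= addr0. Qed.

Lemma const_coef_is_zmod : zmod_morphism const_coef.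
Proof.
move=> x y; have [a [b ->]] := ram_decomp x; have [c [e ->]] := ram_decomp y.
have -> : cst a + cst b * t - (cst c + cst e * t) = cst (a - c) + cst (b - e) * t.
  by rewrite !ram_constD !ram_constN; ring.
by rewrite !const_coefE.
Qed.

Lemma res_const_coef_monoid : monoid_morphism (fun x => res (const_coef x)).
Proof.
have rs : res s = 0 by apply/(resP.2); exists 1; rewrite mul1r.
split=> [|x y].
  have -> : 1 = cst 1 + cst 0 * t by rewrite ram_const1 ram_const0; ring.
  by rewrite const_coefE rmorph1.
have [a [b ->]] := ram_decomp x; have [c [e ->]] := ram_decomp y.
have -> : (cst a + cst b * t) * (cst c + cst e * t) =
   cst (a * c + b * e * s) + cst (a * e + b * c) * t.
  rewrite !ram_constD !ram_constM -ram_tt; ring.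
by rewrite !const_coefE rmorphD !rmorphM rs mulr0 addr0.
Qed.

Lemma principal_tE x : principal t x <-> res (const_coef x) = 0.
Proof.
split=> [[y ->]|/resP.2[a]].
  have /= -> := res_const_coef_monoid.2 y t.
  have -> : t = cst 0 + cst 1 * t by rewrite ram_const1 ram_const0; ring.
  by rewrite const_coefE rmorph0 mulr0.
have [c [e ->]] := ram_decomp x; rewrite const_coefE => ->.
exists (cst e + cst a * t); rewrite ram_constM -ram_tt; ring.
Qed.

(** The map sending [x] to [res (const_coef x)] has kernel generated by [t], which contains the
    kernel of [projA Q]; it therefore descends, with values computed on chosen preimages. *)
Lemma residue_map : exists rho : {rmorphism extA Q -> Fq},
  forall x, rho (projA Q x) = res (const_coef x).
Proof.
have [surj ker] := projA_quotient Q.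
have ex a : exists x, projA Q x == a by have [x <-] := surj a; exists x.
pose f a := res (const_coef (xchoose (ex a))).
have fE x : f (projA Q x) = res (const_coef x).
  have /eqP := xchooseP (ex (projA Q x)); rewrite -/(f _) /f.
  set y := xchoose _ => Exy; apply/eqP; rewrite -subr_eq0 -rmorphB -const_coef_is_zmod.
  apply/eqP/principal_tE.
  have /ker[z ->] : projA Q (y - x) = 0 by rewrite rmorphB Exy subrr.
  have -> : (2 * k.+1 - 1 = (2 * k).+1)%N by rewrite mulnS addSn subn1.
  by exists (z * t ^+ (2 * k)); rewrite (exprSr t) mulrA.
have fB : zmod_morphism f.
  move=> a b; have [x <-] := surj a; have [y <-] := surj b.
  by rewrite -rmorphB !fE const_coef_is_zmod rmorphB.
have fM : monoid_morphism f.
  split; first by rewrite -(rmorph1 (projA Q)) fE res_const_coef_monoid.1.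
  move=> a b; have [x <-] := surj a; have [y <-] := surj b.
  by rewrite -rmorphM !fE res_const_coef_monoid.2.
pose rho : {rmorphism extA Q -> Fq} := HB.pack f
  (GRing.isZmodMorphism.Build _ _ f fB) (GRing.isMonoidMorphism.Build _ _ f fM).
by exists rho.
Qed.

(** If [s = 0], the zero ideal is maximal, so the proper ideal generated by a nonzero non-unit would
    be 0. *)
Lemma uniformizer_neq0 : s != 0.
Proof.
have [_ [x nzx nux] [_ _ maxs] _] := sP.
apply: contraNneq nux => s0; apply: contraT => nux; case/eqP: nzx.
have [||||y ->] := maxs (principal x) _ _ _ x; last by rewrite s0 mulr0.
- split=> [|a b [u ->] [v ->]|a b [u ->]]; first by exists 0; rewrite mul0r.
    by exists (u + v); rewrite mulrDl.
  by exists (a * u); rewrite mulrA.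
- by move=> y [z ->]; exists 0; rewrite s0 mulr0 mul0r.
- case=> y y1; case/negP: nux; apply/unitrPr; exists y; by rewrite mulrC.
by exists 1; rewrite mul1r.
Qed.

Lemma quotient_chain_ring : exists rho : {rmorphism extA Q -> Fq},
  ramified_chain_ring (starA Q) (projA Q t) rho k.
Proof.
have [rho rhoE] := residue_map; exists rho.
have [surj ker] := projA_quotient Q.
have Eell : (2 * k.+1 - 1 = k.*2.+1)%N by rewrite mulnS addSn subn1 mul2n.
split.
- move=> a; have [x <-] := surj a; have [b [c ->]] := ram_decomp x.
  rewrite !starA_proj ram_conjE; congr (projA Q _).
  have -> : cst b - cst c * t = cst b + cst (- c) * t by rewrite ram_constN; ring.
  by rewrite ram_conjE ram_constN; ring.
- have Et : t = cst 0 + cst 1 * t by rewrite ram_const1 ram_const0; ring.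
  rewrite [in LHS]Et starA_proj ram_conjE -[RHS](rmorphN (projA Q)).
  by congr (projA Q _); rewrite ram_const0 ram_const1; ring.
- move=> a; have [x <-] := surj a; have [b [c ->]] := ram_decomp x.
  have fixc e : starA Q (projA Q (cst e)) = projA Q (cst e).
    rewrite starA_proj; have -> : cst e = cst e + cst 0 * t.
      by rewrite ram_const0; ring.
    by rewrite ram_conjE; congr (projA Q _); rewrite ram_const0; ring.
  by exists (projA Q (cst b)), (projA Q (cst c)); rewrite !fixc rmorphD rmorphM.
- by rewrite -rmorphXn; apply/ker; rewrite Eell; exists 1; rewrite mul1r.
(* Since [t ^+ k.*2 = s ^+ k], its vanishing in the quotient would make [s ^+ k] a multiple of
   [s ^+ k.+1], hence [s] a unit. *)
- apply/negP; rewrite -rmorphXn => /eqP/ker.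
  rewrite -mul2n (exprM t) (expr2 t) ram_tt.
  rewrite -ram_constX.
  move/ram_const_principal => -/(_ isT)[c Ec].
  have [_ _ [_ nu1 _] _] := sP; apply: nu1; exists c.
  have nzs := expf_neq0 k uniformizer_neq0.
  by apply: (mulIf nzs); rewrite mul1r {1}Ec exprS mulrA.
- move=> z; have [a <-] := resP.1 z; exists (projA Q (cst a)); rewrite rhoE.
  have -> : cst a = cst a + cst 0 * t by rewrite ram_const0; ring.
  by rewrite const_coefE.
- move=> a; have [x <-] := surj a; rewrite rhoE -principal_tE.
  split=> [[y ->]|[b]]; first by exists (projA Q y); rewrite mulrC rmorphM.
  have [y <-] := surj b; rewrite -rmorphM => /eqP.
  rewrite -subr_eq0 -rmorphB => /eqP/ker[z Ez].
  exists (y + z * t ^+ k.*2); rewrite -[x](subrK (t * y)) Ez Eell (exprSr t); ring.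
- by apply: contra pchar2 => two0; rewrite inE /= two0.
Qed.
End RamifiedQuotient.

(** * The Weil module *)

Section AlternatingForm.
Variables (O : idomainType) (s : O) (Fq : finFieldType).
Variables (k : nat) (Q : quotient_rings s k.+1) (m : nat) (h : skew_hermitian Q m).
Variables (rho : {rmorphism extA Q -> Fq}).
Hypothesis AP : ramified_chain_ring (starA Q) (projA Q (ram_t s)) rho k.
Hypothesis h_nondeg : nondegenerate_herm h.

Local Notation f := (alt_form h).

Lemma herm_skew_form : skew_form (starA Q) h.
Proof.
split=> [u v w|u a v|u v|u u0]; [exact: hermDr | exact: hermZr | exact: herm_skew |].
apply: h_nondeg => v; rewrite u0.
by rewrite -[X in h X v](scale0r 0) hermZl rmorph0 mul0r.
Qed.

Lemma starA_embR a : starA Q (embR Q a) = embR Q a.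
Proof.
have [b <-] := (projR_quotient Q).1 a; rewrite embR_proj starA_proj.
have -> : ram_const s b = ram_const s b + ram_const s 0 * ram_t s.
  by rewrite ram_const0; ring.
by rewrite ram_conjE ram_const0; congr (projA Q _); ring.
Qed.

Lemma alt_formC u v : f v u = - f u v.
Proof.
apply: embR_inj; rewrite rmorphN !embR_halftr (herm_skew h u v) rmorphN /=.
by rewrite (chain_starK AP); ring.
Qed.

Lemma alt_formvv u : f u u = 0.
Proof.
apply: embR_inj; rewrite rmorph0 embR_halftr {2}(herm_skew h u u) rmorphN /=.
by rewrite (chain_starK AP) subrr mul0r.
Qed.

Lemma alt_formZl a u v : f (embR Q a *: u) v = a * f u v.
Proof.
apply: embR_inj; rewrite rmorphM !embR_halftr hermZl rmorphM /= !starA_embR.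
by ring.
Qed.

Lemma embR_alt_form2 u v : embR Q (f (u + u) v) = h u v + starA Q (h u v).
Proof.
rewrite embR_halftr hermDl rmorphD; apply: (canLR (mulrK (two_unit AP))); ring.
Qed.

Variables (C : fieldType) (lam : baseR Q -> C).
Hypothesis lamP : primitive_character lam.

Lemma lam_neq0 r : lam r != 0. Proof. by case: lamP. Qed.

Lemma lamD r r' : lam (r + r') = lam r * lam r'. Proof. by case: lamP. Qed.

Lemma lam0 : lam 0 = 1.
Proof. by apply: (mulfI (lam_neq0 0)); rewrite -lamD addr0 mulr1. Qed.

(** The values [f (u + u) x = f u x - f x u] form an ideal of R. If [lam] never distinguished
    [f u x] from [f x u], it would be trivial on this ideal, which by primitivity would be 0,
    against [trace_nondeg]. *)
Lemma lam_alt_nondeg x : x != 0 ->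
  exists u v, u + v = x /\ lam (f u v) != lam (f v u).
Proof.
move=> nx; have [w hw] := trace_nondeg AP herm_skew_form nx.
have [u nu] : exists u, lam (f u x) != lam (f x u).
  apply/existsP; apply: contraNT hw => /existsPn no.
  rewrite -embR_alt_form2; case: lamP => _ _ prm.
  rewrite (_ : f (w + w) x = 0) ?rmorph0 //.
  apply: (prm (fun r => exists u, r = f (u + u) x)); last by exists w.
    split=> [|_ _ [u ->] [v ->]|a _ [u ->]].
    - by exists 0; rewrite addr0 alt_form0l.
    - by exists (u + v); rewrite addrACA [RHS]alt_formDl.
    - by exists (embR Q a *: u); rewrite -scalerDr alt_formZl.
  move=> _ [u ->]; rewrite alt_formDl lamD; have := no u; rewrite negbK => /eqP E.
  by rewrite {2}E -lamD [f x u]alt_formC subrr lam0.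
(* As [f] is alternating, replacing [x] by [x - u] does not change its pairing with [u]. *)
exists u, (x - u); split; first by rewrite addrC subrK.
rewrite alt_formDl alt_formDr alt_formNl [f u (- u)]alt_formC.
by rewrite alt_formNl alt_formvv !oppr0 !addr0.
Qed.

End AlternatingForm.

Lemma pchar0_group (C : numFieldType) (gT : finGroupType) (G : {group gT}) :
  pgroup.pgroup ([pchar C]^') G.
Proof. by apply/pgroup.pgroupP=> p _ _; rewrite inE /= Num.Theory.pchar_num. Qed.

Section WeilModule.
Variables (O : idomainType) (s : O) (Fq : finFieldType).
Variables (k : nat) (Q : quotient_rings s k.+1) (m : nat) (h : skew_hermitian Q m).
Variables (rho : {rmorphism extA Q -> Fq}).
Hypothesis AP : ramified_chain_ring (starA Q) (projA Q (ram_t s)) rho k.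
Hypothesis h_nondeg : nondegenerate_herm h.
Variables (C : numClosedFieldType) (d : nat) (lam : baseR Q -> C).
Variables (S : mx_representation C [set: heisenberg h] d).
Variables (W : mx_representation C (unitary h) d).
Hypothesis lamP : primitive_character lam.
Hypothesis SP : is_schrodinger lam S.
Hypothesis WP : is_weil S W.

Local Notation V := (colspace Q m).
Let hP : skew_form (starA Q) h := herm_skew_form h_nondeg.
Let S0 (u : V) := S (Heis h 0 u).
Let phi (u v : V) := lam (alt_form h u v).

Lemma S_heis r u : S (Heis h r u) = lam r *: S0 u.
Proof.
have -> : Heis h r u = (Heis h r 0 * Heis h 0 u)%g.
  by rewrite /mulg /= alt_form0l !addr0 add0r.
by rewrite repr_mxM ?inE // SP.2 mul_scalar_mx.
Qed.

Lemma S0_0 : S0 0 = 1%:M.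
Proof. exact: (repr_mx1 S). Qed.

Lemma S0M u v : S0 u *m S0 v = phi u v *: S0 (u + v).
Proof.
by rewrite -repr_mxM ?inE // /mulg /= addr0 add0r S_heis.
Qed.

Lemma d_neq0 : d%:R != 0 :> C.
Proof.
have [[_ n1 _] _] := SP; rewrite Num.Theory.pnatr_eq0.
by apply: contraNneq n1 => d0; apply/eqP/matrixP; rewrite d0 => -[].
Qed.

(** An irreducible representation over an algebraically closed field spans the full matrix algebra;
    central elements act by scalars, so the operators [S0 v] already span. *)
Lemma S0_span (M : 'M_d) : exists a : V -> C, M = \sum_v a v *: S0 v.
Proof.
have /mx_abs_irrP[_ [a /(_ M)->]] := group_closure_closed_field SP.1.
exists (fun v => \sum_r a (Heis h r v) M * lam r).
under [RHS]eq_bigr do rewrite scaler_suml.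
rewrite exchange_big pair_big_dep /=.
rewrite (reindex (fun p : baseR Q * V => Heis h p.1 p.2)) /=; last first.
  by exists (@heis_to_pair _ _ _ _ _ _) => [[]|[]].
by apply: eq_big => [p|p _]; rewrite ?inE // S_heis scalerA.
Qed.

Lemma phi_neq0 u v : phi u v != 0.
Proof. exact: lam_neq0. Qed.

Lemma weil_S0 g v : g \in unitary h -> W g *m S0 v = S0 (GLval g *m v) *m W g.
Proof.
by move=> Ug; rewrite /S0 -(WP 0 v Ug) mulmxKV // repr_mx_unit.
Qed.

Lemma GLval_inj g : injective (fun v : V => GLval g *m v).
Proof.
move=> u v /(congr1 (mulmx (invmx (GLval g)))).
by rewrite !mulmxA mulVmx ?GL_unit // !mul1mx.
Qed.

Hypothesis m_gt2 : (2 < m.-1.+1)%N.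
Let m_gt0 : (0 < m.-1.+1)%N := isT.
Let lev := @level (extA Q) (projA Q (ram_t s)) k m.-1.+1 h.

Lemma level_SU u v :
  lev u = lev v <-> exists2 g, g \in special_unitary h & v = GLval g *m u.
Proof.
split=> [/(level_special AP hP _ _ m_gt2)[M [iM dM ->]]|[g]].
  exists (FinRing.Unit (isometry_unit hP iM : M \is a GRing.unit)) => //.
  rewrite !inE /= dM eqxx andbT; apply/forallP=> x; apply/forallP=> y.
  by rewrite iM.
rewrite inE => /andP[/unitary_setP iM _] ->.
by rewrite /lev (level_isometry AP hP).
Qed.

Lemma level_U u v :
  lev u = lev v <-> exists2 g, g \in unitary h & v = GLval g *m u.
Proof.
split=> [/level_SU[g gSU ->]|[g /unitary_setP iM ->]].
  by exists g; rewrite // (subsetP (special_unitary_sub h)).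
by rewrite /lev (level_isometry AP hP).
Qed.

Let WSU := subg_repr W (special_unitary_sub h).

Lemma weil_S0_SU g v :
  g \in special_unitary h -> WSU g *m S0 v = S0 (GLval g *m v) *m WSU g.
Proof. by move=> /(subsetP (special_unitary_sub h)); apply: weil_S0. Qed.

Let nondeg := lam_alt_nondeg AP h_nondeg lamP.

(** Both commutants are cut out by the same condition on coefficients, constancy on the fibres of
    [lev]. *)
Lemma centgmx_SU_U (M : 'M_d) : centgmx WSU M -> centgmx W M.
Proof.
have [a ->] := S0_span M.
move/(centgmx_par S0_0 S0M phi_neq0 nondeg d_neq0
  (fun g _ => @GLval_inj g) weil_S0_SU level_SU) => ca.
exact/(centgmx_par S0_0 S0M phi_neq0 nondeg d_neq0
  (fun g _ => @GLval_inj g) weil_S0 level_U).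
Qed.

Lemma commutant_SU_comm (M M' : 'M_d) :
  centgmx WSU M -> centgmx WSU M' -> M *m M' = M' *m M.
Proof.
have [sigma [sB sI sh sl]] := exists_anti_isometry AP hP m_gt0.
apply: (commutant_comm S0_0 S0M phi_neq0 nondeg d_neq0 S0_span
  (fun g _ => @GLval_inj g) weil_S0_SU level_SU sB sI _ sl).
by move=> u v; rewrite /phi /alt_form sh.
Qed.

Lemma weil_SU_decomposition :
  let N := (2 * \sum_(i < k.+1) #|Fq| ^ i)%N in
  [/\ exists M : 'I_N -> 'M[C]_d,
        [/\ forall i, mxsimple WSU (M i),
            mxdirect (\sum_i M i)%MS,
            (\sum_i M i :=: 1%:M)%MS
          & forall i j, mx_iso WSU (M i) (M j) -> i = j],
      forall M : 'M[C]_d, mxsimple W M -> mxsimple WSU M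
    & forall M M' : 'M[C]_d, mxsimple W M -> mxsimple W M' ->
        mx_iso WSU M M' -> (M :=: M')%MS].
Proof.
have pSU := pchar0_group C (special_unitary h).
have simpleSU (M : 'M_d) : mxsimple W M -> mxsimple WSU M.
  exact: subg_simple pSU centgmx_SU_U.
split=> // [|M M' sM sM' isoM]; last first.
  exact: (mx_iso_simple_eqmx pSU commutant_SU_comm) (simpleSU _ sM) (simpleSU _ sM') isoM.
rewrite -(card_levels AP hP m_gt2).
apply: (commutative_commutant_decomposition pSU commutant_SU_comm).
  exact: (orbit_sums_free S0_0 S0M phi_neq0 nondeg d_neq0).
exact: (orbit_sums_span S0_0 S0M phi_neq0 nondeg d_neq0 S0_span
  (fun g _ => @GLval_inj g) weil_S0_SU level_SU).
Qed.
End WeilModule.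

Theorem theorem5p5 (RR : realType) (O : idomainType) (s : O)
    (Fq : finFieldType) (res : {rmorphism O -> Fq}) (ell n d : nat)
    (Q : quotient_rings s ell) (h : skew_hermitian Q (2 * n))
    (lam : baseR Q -> RR[i])
    (S : mx_representation RR[i] [set: heisenberg h] d)
    (W : mx_representation RR[i] (unitary h) d) :
  local_pid s ->
  is_quotient res (principal s) -> 2%N \notin [pchar Fq] ->
  (1 <= ell)%N -> (1 < n)%N ->
  nondegenerate_herm h ->
  primitive_character lam ->
  is_schrodinger lam S ->
  is_weil S W ->
  let WSU := subg_repr W (special_unitary_sub h) in
  let N := (2 * \sum_(i < ell) #|Fq| ^ i)%N in
  [/\ exists M : 'I_N -> 'M[RR[i]]_d,
        [/\ forall i, mxsimple WSU (M i),
            mxdirect (\sum_i M i)%MS,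
            (\sum_i M i :=: 1%:M)%MS
          & forall i j, mx_iso WSU (M i) (M j) -> i = j],
      forall M : 'M[RR[i]]_d, mxsimple W M -> mxsimple WSU M
    & forall M M' : 'M[RR[i]]_d, mxsimple W M -> mxsimple W M' ->
        mx_iso WSU M M' -> (M :=: M')%MS].
Proof.
case: ell Q h lam S W => // k Q h lam S W sP resP pchar2 _ n_gt1 hnd lamP SP WP.
have [rho AP] := quotient_chain_ring Q sP resP pchar2.
apply: (weil_SU_decomposition AP hnd lamP SP WP).
by rewrite prednK ?ltn_Pmulr // muln_gt0 (ltnW n_gt1).
Qed.
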